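(* Let $\mathrm{Cusp}:=\{(x,0)\,:\,x\ge 0\}\cup\{(x,x^2)\,:\,x\ge0\}\subset\mathbb{R}^2$, equipped with the Euclidean metric of $\mathbb{R}^2$. Then $\mathcal{F}(\mathrm{Cusp})\approx L^1(Z)$ for some measure space $Z$.
   Context: For a metric space $(X,d)$ with a fixed basepoint $x_0$, $\mathrm{Lip}_0(X)$ is the Banach space of all Lipschitz functions $f:X\to\mathbb{R}$ with $f(x_0)=0$, normed by $\|f\|=\sup_{u\neq v}|f(u)-f(v)|/d(u,v)$. The Lipschitz free space $\mathcal{F}(X)$ is the closed linear span in $\mathrm{Lip}_0(X)^*$ of the evaluations $\delta_x$, $\delta_x(f)=f(x)$, $x\in X$ (up to isometric isomorphism it does not depend on the basepoint). The symbol $\approx$ means linearly isomorphic as Banach spaces. *)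

(* Defs.v *)
From HB Require Import structures.
From mathcomp Require Import all_boot all_order all_algebra.
From mathcomp Require Import all_classical all_reals all_analysis.
From mathcomp Require Import measurable_realfun ring lra.

Set Implicit Arguments.
Unset Strict Implicit.
Unset Printing Implicit Defensive.

Import Order.TTheory GRing.Theory Num.Theory.
Import numFieldNormedType.Exports.

Local Open Scope classical_set_scope.
Local Open Scope ring_scope.

Section Seminorm.
Context {R : realType} (V : lmodType R) (N : V -> R).
Context (N_ge0 : forall x, 0 <= N x).
Context (N_leZ : forall l x, N (l *: x) <= `|l| * N x).

Lemma seminormZ l x : N (l *: x) = `|l| * N x.
Proof.
apply/le_anti; rewrite N_leZ /=.
have [->|l0] := eqVneq l 0; first by rewrite normr0 mul0r.
rewrite -ler_pdivlMl ?normr_gt0//.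
by rewrite -[x in leLHS](scalerK l0) -normfV.
Qed.

End Seminorm.

Lemma sup_le_nneg {R : realType} (A : set R) (M : R) :
  0 <= M -> ubound A M -> sup A <= M.
Proof.
move=> M0 AM; have [->|/set0P A0] := eqVneq A set0; first by rewrite sup0.
exact: ge_sup.
Qed.

Lemma sup_nneg_ge0 {R : realType} (A : set R) :
  (forall x, A x -> 0 <= x) -> 0 <= sup A.
Proof.
move=> A0; have [->|/set0P [a Aa]] := eqVneq A set0; first by rewrite sup0.
have [ub|nub] := pselect (has_ubound A).
  exact: le_trans (A0 _ Aa) (ub_le_sup ub Aa).
by rewrite sup_out// => -[].
Qed.

Section Lip0.
Context {R : realType} {X : metricType R} (x0 : X).

Definition is_lipschitz (f : X -> R) :=
  exists L : R, forall u v, `|f u - f v| <= L * mdist u v.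

Definition Lip0_pred : {pred X -> R^o} :=
  [pred f | `[< is_lipschitz f /\ f x0 = 0 >]].

Record Lip0 := MkLip0 { Lip0_fun :> X -> R^o ; _ : Lip0_fun \in Lip0_pred }.

HB.instance Definition _ := [isSub for Lip0_fun].
HB.instance Definition _ := [Choice of Lip0 by <:].

Lemma Lip0_submod_closed : submod_closed Lip0_pred.
Proof.
split=> [|a f g].
  apply/asboolP; split => //; exists 0 => u v.
  by rewrite subrr normr0 mul0r.
move=> /asboolP[[L Lf] f0] /asboolP[[M Mg] g0]; apply/asboolP; split; last first.
  by rewrite !fctE f0 g0 scaler0 addr0.
exists (`|a| * L + M) => u v.
rewrite !fctE opprD addrACA -scalerBr mulrDl (le_trans (ler_normD _ _))//.
by rewrite lerD// normrM -mulrA ler_wpM2l.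
Qed.

HB.instance Definition _ :=
  GRing.isSubmodClosed.Build _ _ Lip0_pred Lip0_submod_closed.
HB.instance Definition _ := [SubChoice_isSubLmodule of Lip0 by <:].

(* For a one-point [X] the set is empty, and the library's [sup set0] is 0. *)
Definition Lip0_norm (f : Lip0) : R :=
  sup [set `|f p.1 - f p.2| / mdist p.1 p.2 | p in [set p : X * X | p.1 != p.2]].

Lemma Lip0_base (f : Lip0) : f x0 = 0.
Proof. by case: f => f /= /asboolP[]. Qed.

Lemma Lip0_norm_ge0 f : 0 <= Lip0_norm f.
Proof.
by apply: sup_nneg_ge0 => _ [[u v] _ <-]; rewrite divr_ge0 ?mdist_ge0.
Qed.

Lemma Lip0_normP (f : Lip0) u v : `|f u - f v| <= Lip0_norm f * mdist u v.
Proof.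
have [->|uv] := eqVneq u v; first by rewrite subrr normr0 mdistxx mulr0.
have uv0 : 0 < mdist u v by rewrite mdist_gt0.
rewrite -ler_pdivrMr//; apply: ub_le_sup; last by exists (u, v).
case: f => f /= /asboolP[[L Lf] _]; exists L => _ [[u' v'] /= uv' <-].
by rewrite ler_pdivrMr ?mdist_gt0.
Qed.

Lemma Lip0_norm_le (f : Lip0) (L : R) : 0 <= L ->
  (forall u v, `|f u - f v| <= L * mdist u v) -> Lip0_norm f <= L.
Proof.
move=> L0 Lf; apply: sup_le_nneg => // _ [[u v] /= uv <-].
by rewrite ler_pdivrMr ?mdist_gt0.
Qed.

Let Lip0_normD f g : Lip0_norm (f + g) <= Lip0_norm f + Lip0_norm g.
Proof.
apply: Lip0_norm_le => [|u v]; first by rewrite addr_ge0 ?Lip0_norm_ge0.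
rewrite /= opprD addrACA mulrDl (le_trans (ler_normD _ _))//.
by rewrite lerD ?Lip0_normP.
Qed.

Let Lip0_normZ l f : Lip0_norm (l *: f) = `|l| * Lip0_norm f.
Proof.
apply: seminormZ; first exact: Lip0_norm_ge0.
move=> {}l {}f; apply: Lip0_norm_le => [|u v].
  by rewrite mulr_ge0 ?Lip0_norm_ge0.
by rewrite /= -scalerBr normrM -mulrA ler_wpM2l ?Lip0_normP.
Qed.

Let Lip0_norm_eq0 f : Lip0_norm f = 0 -> f = 0.
Proof.
move=> f0; apply/val_inj/funext => u /=.
have := Lip0_normP f u x0; rewrite f0 mul0r Lip0_base subr0 normr_le0.
by move/eqP.
Qed.

HB.instance Definition _ :=
  Lmodule_isNormed.Build R Lip0 Lip0_normD Lip0_normZ Lip0_norm_eq0.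

Lemma Lip0_normE (f : Lip0) : `|f| = Lip0_norm f. Proof. by []. Qed.

End Lip0.

Arguments Lip0 {R X} x0.

Section Dual.
Context {R : realType} (V : normedModType R).

Definition dual_pred : {pred V -> R^o} :=
  [pred f | `[< linear f /\ continuous f >]].

Record dual := MkDual { dual_fun :> V -> R^o ; _ : dual_fun \in dual_pred }.

HB.instance Definition _ := [isSub for dual_fun].
HB.instance Definition _ := [Choice of dual by <:].

Lemma dual_submod_closed : submod_closed dual_pred.
Proof.
split=> [|a f g].
  apply/asboolP; split => [b u v|]; last exact: cst_continuous.
  by change (0 = b *: 0 + 0 :> R^o); rewrite scaler0 addr0.
move=> /asboolP[lf cf] /asboolP[lg cg]; apply/asboolP; split.
  move=> b u v; rewrite !fctE lf lg !scalerDr !scalerA mulrC.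
  by rewrite addrACA.
by move=> x; apply: cvgD (cg x); apply: cvgZl_tmp (cf x).
Qed.

HB.instance Definition _ :=
  GRing.isSubmodClosed.Build _ _ dual_pred dual_submod_closed.
HB.instance Definition _ := [SubChoice_isSubLmodule of dual by <:].

Definition dual_norm (f : dual) : R := sup [set `|f x| | x in [set x | `|x| <= 1]].

Lemma dual_linear (f : dual) : linear f.
Proof. by case: f => f /= /asboolP[]. Qed.

HB.instance Definition _ (f : dual) :=
  GRing.isLinear.Build R V R^o *:%R f (dual_linear f).

Lemma dual_continuous (f : dual) : continuous f.
Proof. by case: f => f /= /asboolP[]. Qed.

Lemma dual_norm_ge0 f : 0 <= dual_norm f.
Proof. by apply: sup_nneg_ge0 => _ [x _ <-]. Qed.

Lemma dual_norm_ubound (f : dual) :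
  has_ubound [set `|f x| | x in [set x | `|x| <= 1]].
Proof.
have : bounded_near f (nbhs (0 : V)).
  by apply/linear_bounded_continuous; exact: dual_continuous.
move=> /bounded_funP/(_ 1)[M Mf]; exists M => _ [x /= x1 <-].
exact: Mf.
Qed.

Lemma dual_normP (f : dual) x : `|f x| <= dual_norm f * `|x|.
Proof.
have [->|x0] := eqVneq x 0; first by rewrite linear0 !normr0 mulr0.
have nx0 : 0 < `|x| by rewrite normr_gt0.
rewrite -ler_pdivrMr//; apply: ub_le_sup; first exact: dual_norm_ubound.
exists (`|x|^-1 *: x) => /=.
  by rewrite normrZ normfV normr_id mulVf// gt_eqF.
by rewrite linearZ /= normrM normfV normr_id mulrC.
Qed.

Lemma dual_norm_le (f : dual) (L : R) : 0 <= L ->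
  (forall x, `|f x| <= L * `|x|) -> dual_norm f <= L.
Proof.
move=> L0 Lf; apply: sup_le_nneg => // _ [x /= x1 <-].
by rewrite (le_trans (Lf x))// ler_piMr.
Qed.

Let dual_normD f g : dual_norm (f + g) <= dual_norm f + dual_norm g.
Proof.
apply: dual_norm_le => [|x]; first by rewrite addr_ge0 ?dual_norm_ge0.
rewrite /= mulrDl (le_trans (ler_normD _ _))//.
by rewrite lerD ?dual_normP.
Qed.

Let dual_normZ l f : dual_norm (l *: f) = `|l| * dual_norm f.
Proof.
apply: seminormZ; first exact: dual_norm_ge0.
move=> {}l {}f; apply: dual_norm_le => [|x].
  by rewrite mulr_ge0 ?dual_norm_ge0.
by rewrite /= normrM -mulrA ler_wpM2l ?dual_normP.
Qed.

Let dual_norm_eq0 f : dual_norm f = 0 -> f = 0.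
Proof.
move=> f0; apply/val_inj/funext => u /=.
have := dual_normP f u; rewrite f0 mul0r normr_le0.
by move/eqP.
Qed.

HB.instance Definition _ :=
  Lmodule_isNormed.Build R dual dual_normD dual_normZ dual_norm_eq0.

Lemma dual_normE (f : dual) : `|f| = dual_norm f. Proof. by []. Qed.

End Dual.

Section ClosedSpan.
Context {R : realType} {V : normedModType R} (A : set V).

Definition linear_span : set V :=
  [set v | exists (n : nat) (a : 'I_n -> R) (x : 'I_n -> V),
    (forall i, A (x i)) /\ v = \sum_(i < n) a i *: x i].

(* The closure is taken for the topology of the norm of [V]. *)
Definition closed_span_pred : {pred V} := mem (closure linear_span).

Record closed_span := MkClosedSpan {
  closed_span_val :> V ; _ : closed_span_val \in closed_span_pred }.

HB.instance Definition _ := [isSub for closed_span_val].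
HB.instance Definition _ := [Choice of closed_span by <:].

Lemma linear_span0 : linear_span 0.
Proof.
exists 0%N, (fun=> 0), (fun=> 0).
by split; [case|rewrite big_ord0].
Qed.

Lemma linear_spanP (a : R) u v :
  linear_span u -> linear_span v -> linear_span (a *: u + v).
Proof.
move=> [m [b [x [Ax ->]]]] [n [c [y [Ay ->]]]].
exists (m + n)%N, (fun i => match fintype.split i with
    inl j => a * b j | inr j => c j end),
  (fun i => match fintype.split i with inl j => x j | inr j => y j end).
split; first by move=> i; case: fintype.split.
rewrite big_split_ord /= scaler_sumr; congr (_ + _); apply: eq_bigr => i _.
  by rewrite (unsplitK (inl i)) scalerA.
by rewrite (unsplitK (inr i)).
Qed.

Lemma closed_span_submod_closed : submod_closed closed_span_pred.
Proof.
split=> [|a u v]; first by apply/mem_set/subset_closure/linear_span0.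
move=> /set_mem cu /set_mem cv; apply/mem_set => B.
have cont : continuous (fun p : V * V => a *: p.1 + p.2).
  move=> p; apply: cvgD; last exact: cvg_snd.
  by apply: cvgZl_tmp; exact: cvg_fst.
move=> /(cont (u, v)) [[C D] [/= /cu[u' [su uC]] /cv[v' [sv vD]]] CDB].
exists (a *: u' + v'); split; first exact: linear_spanP.
exact: (CDB (u', v')).
Qed.

HB.instance Definition _ :=
  GRing.isSubmodClosed.Build _ _ closed_span_pred closed_span_submod_closed.
HB.instance Definition _ := [SubChoice_isSubLmodule of closed_span by <:].

Definition closed_span_norm (v : closed_span) : R := `|val v|.

Let closed_span_normD u v :
  closed_span_norm (u + v) <= closed_span_norm u + closed_span_norm v.
Proof. exact: ler_normD. Qed.

Let closed_span_normZ l v : closed_span_norm (l *: v) = `|l| * closed_span_norm v.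
Proof. exact: normrZ. Qed.

Let closed_span_norm_eq0 v : closed_span_norm v = 0 -> v = 0.
Proof. by move/normr0_eq0 => v0; exact/val_inj. Qed.

HB.instance Definition _ := Lmodule_isNormed.Build R closed_span
  closed_span_normD closed_span_normZ closed_span_norm_eq0.

End ClosedSpan.

Section FreeSpace.
Context {R : realType} {X : metricType R} (x0 : X).

Lemma evaluation_dual (x : X) :
  (fun f : Lip0 x0 => f x) \in @dual_pred R (Lip0 x0).
Proof.
have lin : linear (fun f : Lip0 x0 => f x : R^o) by [].
pose e : {linear Lip0 x0 -> R^o} := HB.pack (fun f : Lip0 x0 => f x : R^o)
  (GRing.isLinear.Build R (Lip0 x0) R^o *:%R _ lin).
apply/asboolP; split => //.
apply/(@linear_bounded_continuous _ _ _ e)/bounded_funP => r.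
exists (r * mdist x x0) => f fr; rewrite -[e f]subr0 -(Lip0_base f).
by rewrite (le_trans (Lip0_normP f x x0))// ler_wpM2r ?mdist_ge0.
Qed.

Definition evaluation (x : X) : dual (Lip0 x0) := MkDual (evaluation_dual x).

Definition free_space := closed_span (range evaluation).

HB.instance Definition _ := NormedModule.on free_space.

End FreeSpace.

(* The library's [LspaceType1 mu] is the set of classes, modulo equality
   mu-almost everywhere, of real functions with a finite L^1 norm, without
   algebraic structure. Operations are those of representatives; the norm is
   the library's ['N[mu]_1]. *)
Section L1.
Context d (T : measurableType d) (R : realType).
Context (mu : {measure set T -> \bar R}).

Local Notation Lfun1 := (LfunType mu (@lexx _ _ 1%E)).
Local Notation L1 := (LspaceType1 mu).

Lemma L1_memLfun (f : L1) : (f : T -> R) \in Lfun mu 1.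
Proof.
apply/andP; split; apply/mem_set; last exact: Lebesgue_finite.
  exact: (@measurable_funPT _ _ _ _ (repr (f : {mfun_ mu, T >-> measurableTypeR R}))).
Qed.

Definition L1_repr (f : L1) : Lfun1 := Lfun_Sub _ (L1_memLfun f).

Lemma L1_norm_ae (f g : T -> R) : measurable_fun setT f ->
  measurable_fun setT g -> f = g %[ae mu] ->
  ('N[mu]_1[EFin \o f] = 'N[mu]_1[EFin \o g])%E.
Proof.
move=> mf mg fg; rewrite !Lnorm1.
apply: ae_eq_integral => //.
- by apply: measurableT_comp => //; exact/measurable_EFinP.
- by apply: measurableT_comp => //; exact/measurable_EFinP.
- by apply: filterS fg => x /[apply] /= ->.
Qed.

Local Notation Q := {mfun_ mu, T >-> measurableTypeR R}.

(* [R] and [measurableTypeR R] have the same measurable sets but different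
   displays. *)
Definition mfunTR (f : Lfun1) : {mfun T >-> measurableTypeR R} :=
  HB.pack (f : T -> measurableTypeR R)
    (@isMeasurableFun.Build d _ T (measurableTypeR R) f (@measurable_funPT _ _ _ _ f)).

Definition ae_class (f : Lfun1) : Q := (\pi_Q (mfunTR f))%qT.

Lemma ae_classP (f : Lfun1) : (ae_class f : T -> R) = (f : T -> R) %[ae mu].
Proof.
have /eqmodP/asboolP : (\pi_Q (repr (ae_class f)) = \pi_Q (mfunTR f))%qT.
  by rewrite reprK.
by [].
Qed.

Lemma ae_class_finite (f : Lfun1) : finite_norm mu 1%E (ae_class f).
Proof.
rewrite /finite_norm (@L1_norm_ae _ f).
- exact: Lfunction_finite.
- exact: (@measurable_funPT _ _ _ _ (repr (ae_class f))).
- exact: measurable_funPT.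
- exact: ae_classP.
Qed.

HB.instance Definition _ (f : Lfun1) :=
  @isFinLebesgue.Build _ T R mu 1%E (@lexx _ _ 1%E) _ (ae_class_finite f).

Definition L1_class (f : Lfun1) : L1 := ae_class f.

Lemma L1_eqP (f g : L1) : (f : T -> R) = (g : T -> R) %[ae mu] -> f = g.
Proof.
case: f => f [[finf]]; case: g => g [[fing]] /= fg.
have efg : f = g by rewrite -[f]reprK -[g]reprK; apply/eqmodP/asboolP.
by subst g; congr LebesgueSpace.Pack; congr LebesgueSpace.Class;
  congr isFinLebesgue.Axioms_; exact: Prop_irrelevance.
Qed.

Lemma L1_reprK (f : L1) : L1_class (L1_repr f) = f.
Proof. by apply: L1_eqP; exact: ae_classP. Qed.

Lemma L1_class_eq (f g : Lfun1) :
  (f : T -> R) = (g : T -> R) %[ae mu] -> L1_class f = L1_class g.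
Proof.
move=> fg; apply: L1_eqP; apply: ae_eq_trans (ae_classP f) _.
by apply: ae_eq_trans fg _; apply: ae_eq_sym; exact: ae_classP.
Qed.

HB.instance Definition _ := gen_eqMixin L1.
HB.instance Definition _ := gen_choiceMixin L1.

Definition L1_zero : L1 := L1_class 0.
Definition L1_opp (f : L1) : L1 := L1_class (- L1_repr f).
Definition L1_add (f g : L1) : L1 := L1_class (L1_repr f + L1_repr g).
Definition L1_scale (a : R) (f : L1) : L1 := L1_class (a *: L1_repr f).

Lemma L1_addE (f g : Lfun1) : L1_add (L1_class f) (L1_class g) = L1_class (f + g).
Proof.
apply: L1_class_eq.
apply: filterS2 (ae_classP f) (ae_classP g) => x /(_ Logic.I) ef /(_ Logic.I) eg _.
by change (ae_class f x + ae_class g x = f x + g x); rewrite ef eg.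
Qed.

Lemma L1_addP (f g : L1) :
  (L1_add f g : T -> R) = (fun x => f x + g x) %[ae mu].
Proof. exact: ae_classP. Qed.

Lemma L1_scaleP a (f : L1) :
  (L1_scale a f : T -> R) = (fun x => a * f x) %[ae mu].
Proof. exact: ae_classP. Qed.

Lemma L1_scaleE a (f : Lfun1) : L1_scale a (L1_class f) = L1_class (a *: f).
Proof.
apply: L1_class_eq; apply: filterS (ae_classP f) => x /(_ Logic.I) ef _.
by change (a * ae_class f x = a * f x); rewrite ef.
Qed.

Lemma L1_oppE (f : Lfun1) : L1_opp (L1_class f) = L1_class (- f).
Proof.
apply: L1_class_eq; apply: filterS (ae_classP f) => x /(_ Logic.I) ef _.
by change (- ae_class f x = - f x); rewrite ef.
Qed.

Lemma L1_rect (P : L1 -> Prop) : (forall f : Lfun1, P (L1_class f)) -> forall f, P f.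
Proof. by move=> Pc f; rewrite -[f]L1_reprK. Qed.

Let L1_addA : associative L1_add.
Proof. by do 3 elim/L1_rect => ?; rewrite !L1_addE addrA. Qed.

Let L1_addC : commutative L1_add.
Proof. by do 2 elim/L1_rect => ?; rewrite !L1_addE addrC. Qed.

Let L1_add0 : left_id L1_zero L1_add.
Proof. by elim/L1_rect => ?; rewrite L1_addE add0r. Qed.

Let L1_addN : left_inverse L1_zero L1_opp L1_add.
Proof. by elim/L1_rect => ?; rewrite L1_oppE L1_addE addNr. Qed.

HB.instance Definition _ :=
  GRing.isZmodule.Build L1 L1_addA L1_addC L1_add0 L1_addN.

Let L1_scaleA a b (f : L1) : L1_scale a (L1_scale b f) = L1_scale (a * b) f.
Proof. by elim/L1_rect: f => ?; rewrite !L1_scaleE scalerA. Qed.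

Let L1_scale1 : left_id 1 L1_scale.
Proof. by elim/L1_rect => ?; rewrite L1_scaleE scale1r. Qed.

Let L1_scaleDr : right_distributive L1_scale +%R.
Proof.
move=> a; do 2 elim/L1_rect => ?.
by rewrite [X in L1_scale _ X]L1_addE !L1_scaleE scalerDr -L1_addE.
Qed.

Let L1_scaleDl (f : L1) : {morph L1_scale^~ f : a b / a + b}.
Proof.
move=> a b; elim/L1_rect: f => f.
by rewrite !L1_scaleE scalerDl -L1_addE.
Qed.

HB.instance Definition _ := GRing.Zmodule_isLmodule.Build R L1
  L1_scaleA L1_scale1 L1_scaleDr L1_scaleDl.

Definition L1_norm (f : L1) : R := fine 'N[mu]_1[EFin \o f].

Lemma L1_normE (f : Lfun1) : L1_norm (L1_class f) = fine 'N[mu]_1[EFin \o f].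
Proof.
congr fine; apply: L1_norm_ae; [|exact: measurable_funPT|exact: ae_classP].
exact: (@measurable_funPT _ _ _ _ (repr (ae_class f))).
Qed.

Let L1_normD f g : L1_norm (f + g) <= L1_norm f + L1_norm g.
Proof.
elim/L1_rect: f => f; elim/L1_rect: g => g.
by rewrite [f in L1_norm f]L1_addE !L1_normE; exact: ler_LnormD.
Qed.

Let L1_normZ a f : L1_norm (a *: f) = `|a| * L1_norm f.
Proof.
elim/L1_rect: f => f; rewrite [f in L1_norm f]L1_scaleE !L1_normE.
by rewrite LnormZ -finite_norm_fine.
Qed.

Let L1_norm_eq0 f : L1_norm f = 0 -> f = 0.
Proof.
elim/L1_rect: f => f; rewrite L1_normE => /fine_Lnormr_eq0 f0.
exact: L1_class_eq.
Qed.

HB.instance Definition _ :=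
  Lmodule_isNormed.Build R L1 L1_normD L1_normZ L1_norm_eq0.

End L1.

Definition isomorphic {R : realType} (V W : normedModType R) :=
  exists (f : {linear V -> W}) (g : {linear W -> V}),
    [/\ cancel f g, cancel g f, continuous f & continuous g].

Section EuclideanPlane.
Context {R : realType}.

(* The product type [R * R] carries the sup norm in the library. *)
Definition euclidean_dist (p q : R * R) : R :=
  Num.sqrt ((p.1 - q.1) ^+ 2 + (p.2 - q.2) ^+ 2).

Lemma euclidean_distxx p : euclidean_dist p p = 0.
Proof. by rewrite /euclidean_dist !subrr expr0n addr0 sqrtr0. Qed.

Lemma euclidean_dist_eq0 p q : euclidean_dist p q = 0 -> p = q.
Proof.
move=> /eqP; rewrite sqrtr_eq0 => pq.
have : (p.1 - q.1) ^+ 2 + (p.2 - q.2) ^+ 2 == 0.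
  by rewrite eq_le pq addr_ge0 ?sqr_ge0.
rewrite paddr_eq0 ?sqr_ge0// !sqrf_eq0 !subr_eq0 => /andP[/eqP p1 /eqP p2].
by rewrite (surjective_pairing p) p1 p2 -surjective_pairing.
Qed.

Lemma euclidean_distC p q : euclidean_dist p q = euclidean_dist q p.
Proof.
by rewrite /euclidean_dist -[p.1 - q.1]opprB -[p.2 - q.2]opprB !sqrrN.
Qed.

Lemma sqrt_sumsq_triangle (a b c d : R) :
  Num.sqrt ((a + c) ^+ 2 + (b + d) ^+ 2) <=
  Num.sqrt (a ^+ 2 + b ^+ 2) + Num.sqrt (c ^+ 2 + d ^+ 2).
Proof.
have sq_ge0 (x y : R) : 0 <= x ^+ 2 + y ^+ 2 by rewrite addr_ge0 ?sqr_ge0.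
rewrite -[leRHS]ger0_norm ?addr_ge0 ?sqrtr_ge0// -sqrtr_sqr ler_wsqrtr//.
rewrite [leRHS]sqrrD !sqr_sqrtr//.
have : a * c + b * d <= Num.sqrt (a ^+ 2 + b ^+ 2) * Num.sqrt (c ^+ 2 + d ^+ 2).
  rewrite -sqrtrM// (le_trans (ler_norm _))// -sqrtr_sqr ler_wsqrtr//.
  rewrite -subr_ge0 (_ : _ - _ = (a * d - b * c) ^+ 2) ?sqr_ge0//; ring.
by set m := _ * Num.sqrt _ => h; lra.
Qed.

Lemma euclidean_dist_triangle q p r :
  euclidean_dist p r <= euclidean_dist p q + euclidean_dist q r.
Proof.
have e (x y z : R) : x - z = (x - y) + (y - z) by rewrite addrA subrK.
rewrite /euclidean_dist (e p.1 q.1) (e p.2 q.2); exact: sqrt_sumsq_triangle.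
Qed.

Record euclidean_subset (A : set (R * R)) := MkEuclideanSubset {
  euclidean_point :> R * R ; _ : euclidean_point \in A }.

HB.instance Definition _ A := [isSub for @euclidean_point A].
HB.instance Definition _ A := [Choice of euclidean_subset A by <:].

HB.instance Definition _ A := isMetric.Build R (euclidean_subset A)
  (fun p => euclidean_distxx p)
  (fun p q pq => val_inj (euclidean_dist_eq0 pq))
  (fun p q => euclidean_distC p q)
  (fun q p r => euclidean_dist_triangle q p r).

End EuclideanPlane.

Definition cusp_set {R : realType} : set (R * R) :=
  [set (x, 0) | x in [set x | 0 <= x]] `|`
  [set (x, x ^+ 2) | x in [set x | 0 <= x]].

Definition Cusp (R : realType) : metricType R := euclidean_subset (@cusp_set R).

(* Main.v *)
(** The measure space is the real line with Lebesgue measure. Lipschitz functions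
    on the cusp correspond to Lipschitz functions [G] on the line vanishing at
    [0]: the values on the lower branch give [G] on the negative half-line, and
    the difference [h] between the two branches, which satisfies
    [|h(x)| <= C x^2], is unfolded on the positive half-line by
    [h(x) = exp(1/x) G(x^2 exp(-1/x))]. The integrating factor [exp(1/x)] solves
    [h' + h / x^2 = phi], whose right-hand side is bounded exactly when [h]
    comes from a Lipschitz function. Dually, the evaluations at [(x, 0)] and at
    [(x, x^2)], minus the evaluation at the vertex, are sent to [1_]-x, 0]] and to
    [1_]-x, 0] + exp(1/x) 1_]0, x^2 exp(-1/x)]]. Both families of vectors have
    equivalent norms on finite linear combinations and the second one spans a
    dense subspace of L^1, so the closed spans are isomorphic. *)

Require Import Defs.
From HB Require Import structures.
From mathcomp Require Import all_boot all_order all_algebra.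
From mathcomp Require Import all_classical all_reals all_analysis.
From mathcomp Require Import ring lra measurable_realfun.

Set Implicit Arguments.
Unset Strict Implicit.
Unset Printing Implicit Defensive.
Import Order.TTheory GRing.Theory Num.Theory.
Import numFieldNormedType.Exports.

Local Open Scope classical_set_scope.
Local Open Scope ring_scope.

(** * Isomorphisms of closed spans *)

(** Completeness of a normed space in series form, which suits the telescoping series of
    approximants in [comb_graph_total]. *)
Definition abs_summable_cvg {R : realType} (V : normedModType R) :=
  forall u : nat -> V, cvgn [normed series u] -> cvgn (series u).

Section Combinations.
Context {R : realType} (I : Type).

(** A formal combination is a list of coefficient-index pairs, so that the same list can be
    evaluated against two families in two spaces. *)
Definition comb (V : lmodType R) (v : I -> V) (s : seq (R * I)) : V :=
  \sum_(p <- s) p.1 *: v p.2.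

Lemma comb_cat (V : lmodType R) (v : I -> V) s t :
  comb v (s ++ t) = comb v s + comb v t.
Proof. exact: big_cat. Qed.

Definition scale_comb (a : R) (s : seq (R * I)) := [seq (a * p.1, p.2) | p <- s].

Lemma combZ (V : lmodType R) (v : I -> V) a s :
  comb v (scale_comb a s) = a *: comb v s.
Proof.
by rewrite /comb big_map scaler_sumr; apply: eq_bigr => p _; rewrite scalerA.
Qed.

Lemma comb_linear (V W : lmodType R) (J : {linear V -> W}) (v : I -> V) s :
  J (comb v s) = comb (fun i => J (v i)) s.
Proof. by rewrite linear_sum; apply: eq_bigr => p _; rewrite linearZ. Qed.

Lemma linear_span_comb (V : normedModType R) (v : I -> V) :
  linear_span (range v) = range (comb v).
Proof.
apply/seteqP; split=> [_ [n [a [x [xv ->]]]]|_ [s _ <-]].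
  have /choice[j jx] i : exists j, v j = x i by have [j] := xv i; exists j.
  exists [seq (a i, j i) | i <- index_enum 'I_n] => //.
  by rewrite /comb big_map; apply: eq_bigr => i _; rewrite jx.
elim: s => [|[a i] s IH]; first by rewrite /comb big_nil; exact: linear_span0.
rewrite /comb big_cons; apply: linear_spanP => //.
exists 1%N, (fun=> 1), (fun=> v i); split; first by move=> _; exists i.
by rewrite big_ord1 scale1r.
Qed.

End Combinations.

Lemma closure_normP {R : realType} (V : normedModType R) (A : set V) x :
  closure A x <-> forall e, 0 < e -> exists2 y, A y & `|x - y| < e.
Proof.
split=> [cA e e0|Ax B /nbhs_ballP[e /= e0 eB]].
  have [y [Ay xy]] := cA _ (nbhsx_ballx x e e0).
  by exists y => //; move: xy; rewrite -ball_normE.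
have [y Ay xy] := Ax e e0; exists y; split => //; apply: eB.
by rewrite -ball_normE.
Qed.

(** * The closed linear relation generated by two families *)

Section CombinationGraph.
Context {R : realType} (I : Type) (V W : normedModType R).
Context (v : I -> V) (w : I -> W).

(* Closure of the set of pairs [(comb v s, comb w s)]. *)
Definition comb_graph (x : V) (y : W) :=
  forall e, 0 < e -> exists s, `|x - comb v s| < e /\ `|y - comb w s| < e.

Lemma comb_graphP a x y x' y' : comb_graph x y -> comb_graph x' y' ->
  comb_graph (a *: x + x') (a *: y + y').
Proof.
move=> xy xy' e e0; pose d := e / (`|a| + 2).
have a2 : 0 < `|a| + 2 by rewrite ltr_wpDl.
have d0 : 0 < d by rewrite divr_gt0.
have dE : `|a| * d + d < e.
  have -> : e = d * (`|a| + 2) by rewrite divfK// lt0r_neq0.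
  lra.
have [s [xs ys]] := xy d d0; have [t [xt yt]] := xy' d d0.
exists (scale_comb a s ++ t); rewrite !comb_cat !combZ.
split; rewrite opprD addrACA -scalerBr (le_lt_trans (ler_normD _ _))// normrZ (le_lt_trans _ dE)//;
  by rewrite lerD ?ler_wpM2l// ltW.
Qed.

(** The bound survives the limit: an error [d] in both entries costs at most [d + C * d], which is
    [e]. *)
Lemma comb_graph_bound C x y : 0 <= C ->
  (forall s, `|comb w s| <= C * `|comb v s|) ->
  comb_graph x y -> `|y| <= C * `|x|.
Proof.
move=> C0 wv xy; apply/ler_addgt0Pr => e e0.
pose d := e / (C + 1).
have C1 : 0 < C + 1 by rewrite ltr_wpDl.
have d0 : 0 < d by rewrite divr_gt0.
have [s [xs ys]] := xy d d0.
have -> : e = d + C * d by rewrite -[LHS](divfK (lt0r_neq0 C1)) -/d; ring.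
have ws : `|y| <= d + `|comb w s|.
  rewrite -[y in leLHS](subrK (comb w s)) (le_trans (ler_normD _ _))//.
  by rewrite lerD2r ltW.
have vs : `|comb v s| <= `|x| + d.
  rewrite -[comb v s](subrK x) (le_trans (ler_normD _ _))// addrC lerD2l.
  by rewrite distrC ltW.
rewrite (le_trans ws)// [leRHS]addrCA lerD2l (le_trans (wv s))// -mulrDr.
by rewrite ler_wpM2l.
Qed.

(** Combinations approaching [x] at rate [2^-n] have images whose successive differences are
    dominated by a geometric series; completeness of [W] supplies the limit [y]. *)
Lemma comb_graph_total C x : abs_summable_cvg W -> 0 <= C ->
  (forall s, `|comb w s| <= C * `|comb v s|) ->
  closure (linear_span (range v)) x -> exists y, comb_graph x y.
Proof.
move=> cW C0 wv; rewrite linear_span_comb => /closure_normP cx.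
have e_gt0 n : 0 < 2^-1 ^+ n :> R by rewrite exprn_gt0 ?invr_gt0.
have /choice[s xs] n : exists s, `|x - comb v s| < 2^-1 ^+ n.
  by have [_ [s _ <-] xs] := cx _ (e_gt0 n); exists s.
pose u n := comb w (s n.+1) - comb w (s n).
have uE n : series u n = comb w (s n) - comb w (s 0%N).
  by rewrite /series /= telescope_sumr.
(* Factor 2: consecutive approximants lie within [2^-n] and [2^-(n+1)] of [x], hence within
   [2 * 2^-n] of each other. *)
have u_le n : `|u n| <= geometric (2 * C) (2^-1) n.
  have -> : u n = comb w (s n.+1 ++ scale_comb (-1) (s n)).
    by rewrite comb_cat combZ scaleN1r.
  rewrite (le_trans (wv _))//= [2 * C]mulrC -mulrA ler_wpM2l//.
  rewrite comb_cat combZ scaleN1r.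
  have -> : comb v (s n.+1) - comb v (s n) =
      (x - comb v (s n)) - (x - comb v (s n.+1)) by rewrite opprB [RHS]addrC addrA subrK.
  rewrite (le_trans (ler_normB _ _))// mulr2n mulrDl mul1r lerD//; first exact: ltW.
  rewrite (le_trans (ltW (xs _)))// exprS ger_pMl//.
  by rewrite invf_le1// ler1n.
have cu : cvgn (series u).
  apply: cW; apply: (series_le_cvg _ _ u_le) => // [n|].
    by rewrite /= mulr_ge0 ?mulr_ge0// ltW.
  apply: is_cvg_geometric_series; rewrite ger0_norm// invf_lt1// ltr1n//.
exists (limn (series u) + comb w (s 0%N)) => e e0.
have half_lt : \forall n \near \oo, 2^-1 ^+ n < e.
  have h1 : `|2^-1| < 1 :> R by rewrite ger0_norm// invf_lt1// ltr1n.
  have /cvgrPdist_lt/(_ _ e0) := cvg_expr h1; apply: filterS => n.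
  by rewrite sub0r normrN ger0_norm// ltW.
near \oo => n; exists (s n); split.
  rewrite (lt_trans (xs n))//.
  by near: n.
have -> : limn (series u) + comb w (s 0%N) - comb w (s n) =
    limn (series u) - series u n by rewrite uE opprB addrA.
by near: n; move/cvgrPdist_lt : cu; apply.
Unshelve. all: by end_near. Qed.

End CombinationGraph.

Lemma comb_graph_sym {R : realType} I (V W : normedModType R)
  (v : I -> V) (w : I -> W) x y : comb_graph v w x y -> comb_graph w v y x.
Proof. by move=> xy e /xy[s []]; exists s. Qed.

(** By linearity the relation contains the pair [(0, y - y')], to which the bound applies. *)
Lemma comb_graph_fun {R : realType} I (V W : normedModType R)
  (v : I -> V) (w : I -> W) C x y y' : 0 <= C ->
  (forall s, `|comb w s| <= C * `|comb v s|) ->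
  comb_graph v w x y -> comb_graph v w x y' -> y = y'.
Proof.
move=> C0 wv xy xy'; apply/eqP; rewrite -subr_eq0 -normr_le0.
have := comb_graphP (-1) xy' xy.
rewrite !scaleN1r ![- _ + _]addrC subrr => /(comb_graph_bound C0 wv).
by rewrite normr0 mulr0.
Qed.

Lemma linear_le_continuous {R : realType} (V W : normedModType R)
  (J : {linear V -> W}) C : (forall x, `|J x| <= C * `|x|) -> continuous J.
Proof.
move=> JC; apply/linear_bounded_continuous/bounded_funP => r.
exists (`|C| * r) => x xr; rewrite (le_trans (JC x))//.
by rewrite (le_trans (ler_norm _))// normrM normr_id ler_wpM2l.
Qed.

(** The two inequalities make the closed relation the graph of a bijection: [C] gives existence and
    uniqueness of images, [K] the same for preimages, and density of the span of [w] lets the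
    inverse start from all of [W]. Linearity and both cancellations follow from uniqueness. *)
Lemma isomorphic_closed_span {R : realType} I (V W : normedModType R)
    (v : I -> V) (w : I -> W) C K :
  abs_summable_cvg V -> abs_summable_cvg W -> 0 <= C -> 0 <= K ->
  (forall s, `|comb w s| <= C * `|comb v s|) ->
  (forall s, `|comb v s| <= K * `|comb w s|) ->
  (forall y, closure (linear_span (range w)) y) ->
  isomorphic (closed_span (range v)) W.
Proof.
move=> cV cW C0 K0 wv vw dw.
have /choice[T T_graph] (x : closed_span (range v)) :
    exists y, comb_graph v w (val x) y.
  exact/(comb_graph_total cW C0 wv)/set_mem/valP.
have /choice[S S_graph] y : exists x : closed_span (range v), comb_graph v w (val x) y.
  have [x /comb_graph_sym xy] := comb_graph_total cV K0 vw (dw y).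
  have cx : x \in closed_span_pred (range v).
    apply/mem_set; rewrite linear_span_comb; apply/closure_normP => e /xy[s [xs _]].
    by exists (comb v s) => //; exists s.
  by exists (MkClosedSpan cx).
have Tlin : linear T.
  move=> a x x'; apply: (comb_graph_fun C0 wv (T_graph _)).
  exact: comb_graphP.
have Slin : linear S.
  move=> a y y'; apply/val_inj/(comb_graph_fun K0 vw); apply: comb_graph_sym.
    exact: S_graph.
  exact: comb_graphP.
pose T' : {linear closed_span (range v) -> W} :=
  HB.pack T (GRing.isLinear.Build R _ _ *:%R _ Tlin).
pose S' : {linear W -> closed_span (range v)} :=
  HB.pack S (GRing.isLinear.Build R _ _ *:%R _ Slin).
exists T', S'; split.
- move=> x; apply/val_inj/(comb_graph_fun K0 vw); apply: comb_graph_sym.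
    exact: S_graph.
  exact: T_graph.
- by move=> y; apply: (comb_graph_fun C0 wv (T_graph _)); exact: S_graph.
- apply: (@linear_le_continuous _ _ _ T' C) => x.
  exact: (comb_graph_bound C0 wv (T_graph x)).
- apply: (@linear_le_continuous _ _ _ S' K) => y.
  exact: (comb_graph_bound K0 vw (comb_graph_sym (S_graph y))).
Qed.

(** * Combinations in a dual space and its completeness *)

Lemma comb_dual_eval {R : realType} (V : normedModType R) I (v : I -> dual V) s x :
  comb v s x = \sum_(p <- s) p.1 * v p.2 x.
Proof.
rewrite /comb; elim: s => [|p s IH]; first by rewrite !big_nil.
by rewrite !big_cons /= -IH.
Qed.

Lemma series0 (V : zmodType) (u : nat -> V) : series u 0%N = 0.
Proof. by rewrite /series /= big_geq. Qed.

Lemma dual_complete {R : realType} (V : normedModType R) :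
  abs_summable_cvg (dual V).
Proof.
move=> u cu; pose S := limn [normed series u].
have seriesx n x : series u n x = series (fun k => u k x) n.
  rewrite /series /=; elim: n => [|n IH]; first by rewrite !big_geq.
  by rewrite !big_nat_recr//= -IH.
have cux x : cvgn (series (fun k => u k x)).
  apply: (@normed_cvg _ R^o).
  apply: (series_le_cvg _ _ (fun k => dual_normP (u k) x)) => // [n|].
    by rewrite mulr_ge0 ?dual_norm_ge0.
  have -> : series (fun k => dual_norm (u k) * `|x|) = `|x| *: [normed series u].
    by apply/funext => n; rewrite /series /= -mulr_suml; exact: mulrC.
  exact: is_cvgZl_tmp.
pose l x : R^o := limn (series (fun k => u k x)).
have lin : linear l.
  move=> a x y; apply/cvg_lim => //.
  have -> : series (fun k => u k (a *: x + y)) =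
      a *: series (fun k => u k x : R^o) + series (fun k => u k y).
    by apply/funext => n; rewrite -seriesx dual_linear !seriesx.
  by apply: cvgD; [apply: cvgZl_tmp|]; exact: cux.
have le_S n : [normed series u] n <= S.
  apply: (nondecreasing_cvgn_le _ cu); apply/nondecreasing_seqP => k.
  by rewrite /= seriesSr lerDl normr_ge0.
(* Letting [m] tend to infinity gives a tail bound proportional to the norm of [x]: [n = 0] shows
   that the pointwise sum [l] is bounded, large [n] gives convergence in the dual norm. *)
have tail n x : `|l x - series u n x| <= (S - [normed series u] n) * `|x|.
  apply/ler_addgt0Pr => e e0.
  near \oo => m.
  have nm : (n <= m)%N by near: m; exact: nbhs_infty_ge.
  have lm : `|l x - series u m x| < e.
    by rewrite seriesx; near: m; move/cvgrPdist_lt : (cux x); apply.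
  have -> : l x - series u n x =
    (series u m x - series u n x) + (l x - series u m x) by ring.
  rewrite (le_trans (ler_normD _ _))// lerD ?(ltW lm)// !seriesx sub_series_geq//.
  rewrite (le_trans (ler_norm_sum _ _ _))//.
  apply: (@le_trans _ _ (([normed series u] m - [normed series u] n) * `|x|)).
    rewrite sub_series_geq// mulr_suml; apply: ler_sum => k _.
    exact: dual_normP.
  by rewrite ler_wpM2r// lerD2r.
pose L : {linear V -> R^o} := HB.pack l (GRing.isLinear.Build R _ _ *:%R _ lin).
have lV : l \in @dual_pred R V.
  apply/asboolP; split => //; apply: (@linear_le_continuous _ _ _ L S) => x.
  have := tail 0%N x; rewrite seriesx /= !series0 !subr0; exact.
apply/cvg_ex; exists (MkDual lV); apply/cvgrPdist_lt => e e0.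
near=> n.
have Sn : S - [normed series u] n < e.
  rewrite (le_lt_trans (ler_norm _))//.
  by near: n; move/cvgrPdist_lt : cu; apply.
rewrite (le_lt_trans _ Sn)//; apply: dual_norm_le => [|x].
  by rewrite subr_ge0.
exact: tail.
Unshelve. all: by end_near. Qed.

(** * A criterion identifying a free space with a given normed space up to isomorphism *)

Section FreeSpaceCriterion.
Context {R : realType} {X : metricType R} (x0 : X) (W : normedModType R).
Context (w : X -> W) (c : X -> R) (C K : R).
Hypotheses (c_ge0 : forall x, 0 <= c x) (C0 : 0 <= C) (K0 : 0 <= K).
Hypothesis norming : forall z : W,
  exists2 J : {linear W -> R^o}, J z = `|z| & forall y, `|J y| <= `|y|.
Hypothesis wx0 : w x0 = 0.
Hypothesis w_lip : forall x y, `|w x - w y| <= C * mdist x y.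
Hypothesis w_approx : forall (f : Lip0 x0) e, 0 < e ->
  exists2 J : {linear W -> R^o}, (forall y, `|J y| <= K * `|f| * `|y|) &
  forall x, `|J (w x) - f x| <= c x * e.

(** A norming functional [J] of the combination, composed with [w], is a [C]-Lipschitz function
    vanishing at [x0]; testing the evaluations on it recovers the norm. *)
Lemma comb_le_evaluation s : `|comb w s| <= C * `|comb (evaluation x0) s|.
Proof.
have [J Js J1] := norming (comb w s).
have fP : (fun x => J (w x)) \in Lip0_pred x0.
  apply/asboolP; split; last by rewrite wx0 linear0.
  by exists C => x y; rewrite -linearB (le_trans (J1 _)).
pose f : Lip0 x0 := MkLip0 fP.
have fC : `|f| <= C.
  by apply: Lip0_norm_le => // x y; rewrite -linearB (le_trans (J1 _)).
have <- : comb (evaluation x0) s f = `|comb w s|.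
  by rewrite -Js comb_linear comb_dual_eval.
rewrite (le_trans (ler_norm _))// (le_trans (dual_normP _ _))// mulrC.
by rewrite ler_wpM2r ?dual_norm_ge0.
Qed.

(** The approximation error may depend on the point through [c], because a combination involves
    finitely many points: an accuracy [e / A] keeps the total error below [e]. *)
Lemma evaluation_le_comb s : `|comb (evaluation x0) s| <= K * `|comb w s|.
Proof.
apply: dual_norm_le => [|f]; first by rewrite mulr_ge0.
apply/ler_addgt0Pr => e e0.
pose A := \sum_(p <- s) `|p.1| * c p.2 + 1.
have A0 : 0 < A by rewrite ltr_wpDl// sumr_ge0// => p _; rewrite mulr_ge0.
have [J Jf Jw] := w_approx f (divr_gt0 e0 A0).
have -> : comb (evaluation x0) s f =
    J (comb w s) - \sum_(p <- s) p.1 * (J (w p.2) - f p.2).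
  rewrite comb_linear comb_dual_eval /comb -sumrB; apply: eq_bigr => p _ /=.
  by rewrite mulrBr opprB addrC subrK.
rewrite (le_trans (ler_normB _ _))// lerD//.
  by rewrite (le_trans (Jf _))// mulrAC.
rewrite (le_trans (ler_norm_sum _ _ _))//.
apply: (@le_trans _ _ (\sum_(p <- s) `|p.1| * c p.2 * (e / A))).
  by apply: ler_sum => p _; rewrite normrM -mulrA ler_wpM2l.
rewrite -mulr_suml mulrCA -[leRHS]mulr1 ler_wpM2l ?(ltW e0)//.
by rewrite ler_pdivrMr// mul1r lerDl.
Qed.

Lemma free_space_isomorphic : abs_summable_cvg W ->
  (forall y, closure (linear_span (range w)) y) -> isomorphic (free_space x0) W.
Proof.
move=> cW dw; apply: (isomorphic_closed_span _ cW C0 K0) dw.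
- exact: dual_complete.
- exact: comb_le_evaluation.
- exact: evaluation_le_comb.
Qed.

End FreeSpaceCriterion.

(** * The space L^1 *)

Section L1Functions.
Context d (T : measurableType d) (R : realType) (mu : {measure set T -> \bar R}).
Local Notation L1 := (LspaceType1 mu).
Local Notation integrableR f := (mu.-integrable [set: T] (EFin \o f)).
Implicit Types (F : L1) (f g : T -> R).

Lemma L1_integrable F : integrableR (F : T -> R).
Proof. exact/Lfun1_integrable/L1_memLfun. Qed.

Lemma integrableR_measurable f : integrableR f -> measurable_fun setT f.
Proof. by move=> /measurable_int/measurable_EFinP. Qed.

Lemma ae_eq_Rintegral f g : measurable_fun setT f -> measurable_fun setT g ->
  f = g %[ae mu] -> \int[mu]_x f x = \int[mu]_x g x.
Proof.
move=> mf mg fg; congr fine; apply: ae_eq_integral => //.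
- exact/measurable_EFinP.
- exact/measurable_EFinP.
- by apply: filterS fg => x /[apply] /= ->.
Qed.

Lemma norm_L1E F : `|F| = \int[mu]_x `|F x|.
Proof. by rewrite /Rintegral [LHS]/(L1_norm F) /L1_norm Lnorm1. Qed.

Lemma L1_norm_ae_eq F f : integrableR f -> (F : T -> R) = f %[ae mu] ->
  `|F| = \int[mu]_x `|f x|.
Proof.
move=> intf Ff; rewrite norm_L1E; apply: ae_eq_Rintegral.
- exact/measurableT_comp/integrableR_measurable/L1_integrable.
- exact/measurableT_comp/integrableR_measurable.
- by apply: filterS Ff => x /[apply] ->.
Qed.

Lemma L1_linearE (a : R) F G :
  (a *: F + G : T -> R) = (fun x => a * F x + G x) %[ae mu].
Proof.
apply: filterS2 (L1_addP (a *: F) G) (L1_scaleP a F) => x.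
by move=> /(_ Logic.I) FG /(_ Logic.I) aF _; rewrite [LHS]FG [X in X + _]aF.
Qed.

(* Junk value [0] when [f] is not integrable. *)
Definition L1_of f : L1 :=
  if pselect (integrableR f) is left h
  then L1_class (Lfun_Sub (lexx 1%E) ((Lfun1_integrable mu f).2 h)) else 0.

Lemma L1_ofP f : integrableR f -> (L1_of f : T -> R) = f %[ae mu].
Proof. by rewrite /L1_of; case: pselect => // h _; exact: ae_classP. Qed.

Lemma norm_L1_of f : integrableR f -> `|L1_of f| = \int[mu]_x `|f x|.
Proof. by move=> intf; apply: L1_norm_ae_eq => //; exact: L1_ofP. Qed.

Lemma L1_ofK F : L1_of F = F.
Proof. by apply: L1_eqP; apply: L1_ofP; exact: L1_integrable. Qed.

Lemma integrableR_linear (a : R) f g : integrableR f -> integrableR g ->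
  integrableR (fun x => a * f x + g x).
Proof.
move=> intf intg.
have -> : EFin \o (fun x => a * f x + g x) =
    (fun x => a%:E * (EFin \o f) x)%E \+ (EFin \o g) :> (T -> \bar R) by [].
by apply: integrableD => //; exact: integrableZl.
Qed.

Lemma L1_of_linear (a : R) f g : integrableR f -> integrableR g ->
  L1_of (fun x => a * f x + g x) = a *: L1_of f + L1_of g.
Proof.
move=> intf intg; apply: L1_eqP.
have ofE := L1_ofP (integrableR_linear a intf intg).
apply: filterS3 (filterI ofE (L1_linearE a (L1_of f) (L1_of g)))
  (L1_ofP intf) (L1_ofP intg) => x [/(_ Logic.I) e1 /(_ Logic.I) e2].
by move=> /(_ Logic.I) e3 /(_ Logic.I) e4 _; rewrite e1 e2 e3 e4.
Qed.

Lemma L1_ofB f g : integrableR f -> integrableR g ->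
  L1_of (fun x => f x - g x) = L1_of f - L1_of g.
Proof.
move=> intf intg; rewrite addrC -scaleN1r -L1_of_linear//; congr L1_of.
by apply/funext => x; rewrite mulN1r addrC.
Qed.

Lemma L1_of_cvg (u : nat -> T -> R) f : (forall n, integrableR (u n)) ->
  integrableR f ->
  (\int[mu]_x `|(u n x)%:E - (f x)%:E| @[n --> \oo] --> 0)%E ->
  L1_of (u n) @[n --> \oo] --> L1_of f.
Proof.
move=> intu intf /fine_cvgP[_] /cvgrPdist_lt uf; apply/cvgrPdist_lt => e /uf.
apply: filterS => n /=; rewrite sub0r normrN => /(le_lt_trans (ler_norm _)).
rewrite distrC -L1_ofB// norm_L1_of//.
have -> : (fun x => u n x - f x) = (fun x => -1 * f x + u n x).
  by apply/funext => x; rewrite mulN1r addrC.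
exact: integrableR_linear.
Qed.

End L1Functions.

(** * Bounded functionals on L^1 and completeness of L^1 *)

Section L1Pairing.
Context d (T : measurableType d) (R : realType) (mu : {measure set T -> \bar R}).
Local Notation L1 := (LspaceType1 mu).
Local Notation integrableR f := (mu.-integrable [set: T] (EFin \o f)).
Implicit Types (F : L1) (f g : T -> R).

Lemma integrableR_mul (K : R) g f : measurable_fun setT g ->
  (forall x, `|g x| <= K) -> integrableR f -> integrableR (fun x => g x * f x).
Proof.
move=> mg gK intf.
have -> : EFin \o (fun x => g x * f x) = ((EFin \o g) \* (EFin \o f))%E by [].
apply: integrableMr => //; exists K; split; first exact: num_real.
by move=> M KM x _; rewrite /= (le_trans (gK x))// ltW.
Qed.

Lemma L1_pairing (K : R) g : measurable_fun setT g -> (forall x, `|g x| <= K) ->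
  exists2 J : {linear L1 -> R^o}, forall F, J F = \int[mu]_x (g x * F x) &
    forall F, `|J F| <= K * `|F|.
Proof.
move=> mg gK; pose J F : R^o := \int[mu]_x (g x * F x).
have intgF F := integrableR_mul mg gK (L1_integrable F).
have lin : linear J.
  move=> a F G; rewrite /J.
  rewrite (@ae_eq_Rintegral _ _ _ _ _ (fun x => a * (g x * F x) + g x * G x)).
  - rewrite RintegralD//; last first.
      exact: (@integrableZl _ _ _ _ _ measurableT a (EFin \o (fun x => g x * F x))).
    by rewrite RintegralZl.
  - exact: integrableR_measurable.
  - exact/integrableR_measurable/integrableR_linear.
  - apply: filterS (L1_linearE a F G) => x /(_ Logic.I) -> _; ring.
pose J' : {linear L1 -> R^o} := HB.pack J (GRing.isLinear.Build R _ _ *:%R _ lin).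
exists J' => // F; rewrite /= /J (le_trans (le_normr_Rintegral _ _))// norm_L1E -RintegralZl//; last first.
  exact: integrable_norm (L1_integrable F).
apply: le_Rintegral => //.
- exact: integrable_norm.
- apply: (@integrableZl _ _ _ _ _ measurableT K (EFin \o (fun x => `|F x|))).
  exact: integrable_norm (L1_integrable F).
- by move=> x _; rewrite normrM ler_wpM2r.
Qed.

(** The functional is integration against the sign of [F], with value 1 where [F] vanishes. *)
Lemma L1_norming F :
  exists2 J : {linear L1 -> R^o}, J F = `|F| & forall G, `|J G| <= `|G|.
Proof.
pose g x : R := if 0 <= F x then 1 else -1.
have mg : measurable_fun setT g.
  apply: measurable_fun_ifT => //.
  by apply: measurable_fun_ler => //; exact/integrableR_measurable/L1_integrable.
have g1 x : `|g x| <= 1 by rewrite /g; case: ifP; rewrite ?normrN normr1.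
have [J JE J1] := L1_pairing mg g1; exists J; last first.
  by move=> G; rewrite (le_trans (J1 G))// mul1r.
rewrite JE norm_L1E; apply: eq_Rintegral => x _; rewrite /g.
by case: ifPn => [/ger0_norm->|]; rewrite ?mul1r// -ltNge mulN1r => /ltr0_norm.
Qed.

(** Riesz-Fischer argument: the sum [g] of the absolute values is integrable and dominates all
    partial sums, so dominated convergence applies. *)
Lemma L1_complete : abs_summable_cvg L1.
Proof.
move=> u cu.
have mu_ n : measurable_fun setT (u n : T -> R).
  exact/integrableR_measurable/L1_integrable.
pose g x := (\sum_(0 <= n <oo) `|u n x|%:E)%E.
have mg : measurable_fun setT g.
  apply: ge0_emeasurable_sum => // n _.
  exact/measurable_EFinP/measurableT_comp.
have intu n : (\int[mu]_x `|u n x|%:E = `|u n|%:E)%E.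
  rewrite norm_L1E /Rintegral fineK//; apply: integrable_fin_num => //.
  exact: integrable_norm (L1_integrable (u n)).
have g0 x : (0 <= g x)%E by apply: nneseries_ge0 => n _ _; rewrite lee_fin.
have intg : mu.-integrable setT g.
  apply/integrableP; split => //.
  under eq_integral => x _ do rewrite gee0_abs//.
  rewrite integral_nneseries//; last first.
    by move=> n; exact/measurable_EFinP/measurableT_comp.
  rewrite (eq_eseriesr (fun n _ => intu n)).
  have -> : (\sum_(0 <= n <oo) `|u n|%:E = (limn [normed series u])%:E)%E.
    rewrite -EFin_lim//; congr (limn _); apply/funext => n.
    by rewrite /= sumEFin.
  exact: ltry.
(* As [g] is finite off a null set, cutting the terms to [E] makes the series converge at every
   point, and [f] is a measurable pointwise limit. *)
pose E := [set x | (g x < +oo)%E].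
have mE : measurable E.
  by rewrite -[E]setTI; exact: emeasurable_fun_infty_o.
have aeE : {ae mu, forall x, E x}.
  apply: filterS (integrable_ae measurableT intg) => x /(_ Logic.I).
  by rewrite ge0_fin_numE.
pose U n x : R := u n x * \1_E x.
have cU x : cvgn (series (U^~ x)).
  apply: (@normed_cvg _ R^o); apply: nnseries_is_cvg => [n|]; first exact: normr_ge0.
  have [Ex|nEx] := pselect (E x).
    by under eq_eseriesr => n _ do rewrite /U indicE mem_set//= mulr1.
  rewrite eseries0// => n _ _.
  by rewrite /U indicE memNset//= mulr0 normr0.
pose f x := limn (series (U^~ x)).
have mseries n : measurable_fun setT (fun x => series (U^~ x) n).
  by apply: measurable_sum => k; apply: measurable_funM => //; exact: measurable_indic.
have mf : measurable_fun setT f.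
  by apply: (measurable_fun_cvg mseries) => x _; exact: cU.
have UE n x : E x -> U n x = u n x by move=> Ex; rewrite /U indicE mem_set//= mulr1.
(* Sums of classes agree with sums of representatives only almost everywhere, one null set being
   added at each step of the induction. *)
have seriesE n : {ae mu, forall x, series u n x = series (U^~ x) n}.
  elim: n => [|n IH].
    by apply: filterS (ae_classP (0 : LfunType mu (lexx 1%E))) => x /(_ Logic.I);
      rewrite !series0.
  apply: filterS3 IH aeE (L1_addP (series u n) (u n)) => x IH Ex /(_ Logic.I) uD.
  by rewrite seriesSr [LHS]uD IH seriesSr UE.
have Ug n x : E x -> (`|series (U^~ x) n|%:E <= g x)%E.
  move=> Ex; apply: (@le_trans _ _ (\sum_(0 <= k < n) `|u k x|%:E)%E).
    rewrite sumEFin lee_fin (le_trans (ler_norm_sum _ _ _))//.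
    by apply: ler_sum => k _; rewrite UE.
  by apply: nneseries_lim_ge => k _ _; rewrite lee_fin.
have [intf + _] : [/\ mu.-integrable setT (EFin \o f),
    [sequence (\int[mu]_x `|(series (U^~ x) n)%:E - (f x)%:E|)%E]_n @ \oo --> 0%E &
    [sequence (\int[mu]_x (series (U^~ x) n)%:E)%E]_n @ \oo -->
      (\int[mu]_x (f x)%:E)%E].
  apply: (dominated_convergence measurableT _ _ _ intg).
  - by move=> n; exact/measurable_EFinP.
  - exact/measurable_EFinP.
  - by apply: aeW => x _; apply: cvg_EFin; [exact: nearW|exact: cU].
  - by apply: filterS aeE => x Ex n _; exact: Ug.
move=> cf; apply/cvg_ex; exists (L1_of mu f).
have -> : series u = (fun n => L1_of mu (series u n)).
  by apply/funext => n; rewrite L1_ofK.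
apply: L1_of_cvg => //; first by move=> n; exact: L1_integrable.
apply: cvg_trans cf; apply: near_eq_cvg; apply: nearW => n.
have mabsB (v w : T -> R) : measurable_fun setT v -> measurable_fun setT w ->
    measurable_fun setT (fun x => `|(v x)%:E - (w x)%:E|%E).
  by move=> mv mw; apply/measurable_EFinP/measurableT_comp => //; exact: measurable_funB.
apply: ae_eq_integral => //.
- exact: mabsB.
- by apply: mabsB => //; exact/integrableR_measurable/L1_integrable.
- by apply: filterS (seriesE n) => x uU _ /=; rewrite uU.
Qed.

End L1Pairing.

Section L1Limits.
Context d (T : measurableType d) (R : realType) (mu : {measure set T -> \bar R}).
Local Notation L1 := (LspaceType1 mu).
Local Notation integrableR f := (mu.-integrable [set: T] (EFin \o f)).
Implicit Types (F : L1) (f g : T -> R).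

(** Dominated convergence gives convergence in the mean, which is convergence in the norm of L^1. *)
Lemma closed_L1_of_dominated (M : set L1) (u : nat -> T -> R) f g :
  closed M -> (forall n, measurable_fun setT (u n)) -> measurable_fun setT f ->
  integrableR g -> (forall n x, `|u n x| <= g x) ->
  (forall x, u n x @[n --> \oo] --> f x) ->
  (forall n, M (L1_of mu (u n))) -> M (L1_of mu f).
Proof.
move=> cM mu_ mf intg ug uf Mu.
have intu n : integrableR (u n).
  apply: (le_integrable measurableT _ _ intg) => [|x _].
    exact/measurable_EFinP.
  by rewrite /= lee_fin (le_trans (ug n x))// ler_norm.
have [intf cuf _] : [/\ integrableR f,
    [sequence (\int[mu]_x `|(u n x)%:E - (f x)%:E|)%E]_n @ \oo --> 0%E &
    [sequence (\int[mu]_x (u n x)%:E)%E]_n @ \oo --> (\int[mu]_x (f x)%:E)%E].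
  apply: (dominated_convergence measurableT _ _ _ intg).
  - by move=> n; exact/measurable_EFinP.
  - exact/measurable_EFinP.
  - by apply: aeW => x _; apply: cvg_EFin; [exact: nearW|exact: uf].
  - by apply: aeW => x n _; rewrite /= lee_fin.
apply: (closed_cvg (fun F => M F)) (L1_of_cvg intu intf cuf) => //.
exact: nearW.
Qed.

End L1Limits.

Import HBSimple.

(** * Density of interval indicators in L^1 of the line *)

Section LebesgueL1.
Context {R : realType}.
Notation mu := (@lebesgue_measure R).
Notation L1 := (LspaceType1 mu).
Implicit Types (A : set (measurableTypeR R)).

Section DenseSubspace.
Variable M : set L1.
Hypotheses (cM : closed M).
Hypothesis M_linear : forall a F G, M F -> M G -> M (a *: F + G).
Hypothesis M_itv : forall a b : R, a <= b -> M (L1_of mu (\1_(`]a, b]%classic))).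

(** Bounded windows: the line has infinite measure, so indicators are cut to [D n] to be
    integrable. *)
Let D (n : nat) : set (measurableTypeR R) := `]- n%:R, n%:R]%classic.

Let measurable_D n : measurable (D n).
Proof. exact: measurable_itv. Qed.

Let integrable_D A n : measurable A -> mu.-integrable setT (EFin \o (\1_(A `&` D n) : R -> R)).
Proof.
move=> mA; apply: (le_integrable measurableT) (integrable_indic_itv (- n%:R) n%:R false false).
  by apply/measurable_EFinP; apply: measurable_indic; exact: measurableI.
move=> x _; rewrite /= lee_fin !ger0_norm ?indicE// ler_nat.
by case: (boolP (x \in A `&` D n)) => //; rewrite inE => -[_ Dx]; rewrite mem_set.
Qed.

Let M_ocitv A : ocitv A -> M (L1_of mu \1_A).
Proof.
move=> [[a b] _ <-]; have [ab|ba] := leP a b; first exact: M_itv.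
rewrite /= set_itv_ge ?bnd_simp -?leNgt ?(ltW ba)// indic0.
by have := M_itv (lexx 0); rewrite set_itv_ge ?bnd_simp ?ltxx// indic0.
Qed.

(** Dynkin induction from the half-open intervals, which are stable under intersection. Complements
    use linearity; disjoint unions are limits of finite ones, dominated by the indicator of
    [D n]. *)
Let M_indicD A n : measurable A -> M (L1_of mu \1_(A `&` D n)).
Proof.
move=> mA; pose P (B : set (measurableTypeR R)) := M (L1_of mu \1_(B `&` D n)).
apply: (@dynkin_induction _ (measurableTypeR R) (@ocitv R) P) mA => //; rewrite /P.
- exact: ocitvI.
- by rewrite setTI; apply: M_ocitv; exists (- n%:R, n%:R).
- by move=> B oB; apply: M_ocitv; apply: ocitvI => //; exists (- n%:R, n%:R).
- move=> B mB MB.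
  have -> : \1_(~` B `&` D n) = (fun x => -1 * \1_(B `&` D n) x + \1_(setT `&` D n) x : R).
    apply/funext => x; rewrite setTI !indicE in_setI in_setC in_setI.
    by case: (x \in B); case: (x \in D n); rewrite /=; ring.
  rewrite L1_of_linear//; [|exact: integrable_D..].
  by apply: M_linear => //; rewrite setTI; apply: M_ocitv; exists (- n%:R, n%:R).
- move=> F mF tF MF.
  have mU k : measurable (\big[setU/set0]_(i < k) F i).
    by apply: bigsetU_measurable => i _; exact: mF.
  apply: (@closed_L1_of_dominated _ _ _ _ M
      (fun k => \1_((\big[setU/set0]_(i < k) F i) `&` D n)) _ (\1_(setT `&` D n))) => //.
  + by move=> k; apply: measurable_indic; exact: measurableI.
  + by apply: measurable_indic; apply: measurableI => //; exact: bigcup_measurable.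
  + exact: integrable_D.
  + move=> k x; rewrite setTI ger0_norm ?indicE// ler_nat in_setI.
    by case: (x \in D n); rewrite ?andbF//; case: (_ \in _).
  + move=> x; have [[N _ FNx]|nFx] := pselect ((\bigcup_k F k) x).
      apply: cvg_near_cst; near=> k.
      have Fkx : (\big[setU/set0]_(i < k) F i) x.
        rewrite -bigcup_mkord; exists N => //=; near: k; exact: nbhs_infty_gt.
      rewrite !indicE !in_setI; congr ((_ && _)%:R : R).
      by rewrite !mem_set//; exists N.
    apply: cvg_near_cst; apply: nearW => k.
    rewrite !indicE !in_setI; congr ((_ && _)%:R : R).
    rewrite !memNset// -bigcup_mkord => -[i _ Fi].
    by apply: nFx; exists i.
  + elim=> [|k IH].
      by rewrite big_ord0 set0I; apply: M_ocitv; exact: ocitv0.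
    have -> : \1_(\big[setU/set0]_(i < k.+1) F i `&` D n) =
        (fun x => 1 * \1_(F k `&` D n) x + \1_(\big[setU/set0]_(i < k) F i `&` D n) x : R).
      apply/funext => x; rewrite !indicE !in_setI big_ord_recr /= in_setU.
      have [/set_mem Fkx|_] := boolP (x \in F k); last first.
        by rewrite orbF /= mul1r add0r.
      rewrite (@memNset _ (\big[setU/set0]_(i < k) F i)) /= ?mul1r ?addr0//.
      rewrite -bigcup_mkord => -[i /= ik Fix]; move: ik.
      by rewrite (tF i k Logic.I Logic.I) ?ltnn//; exists x.
    rewrite L1_of_linear//; [|exact: integrable_D..].
    exact: M_linear.
Unshelve. all: by end_near. Qed.

(** The cuts of [f] to [D n] are dominated by its absolute value, and each is a finite combination
    of the indicators already treated. *)
Let M_sfun (f : {sfun (measurableTypeR R) >-> R}) :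
  mu.-integrable setT (EFin \o f) -> M (L1_of mu f).
Proof.
move=> intf.
apply: (@closed_L1_of_dominated _ _ _ _ M (fun n x => f x * \1_(D n) x) _ (fun x => `|f x|)) => //.
- by move=> n; apply: measurable_funM => //; exact: measurable_indic.
- exact: integrable_norm.
- move=> n x; rewrite normrM ler_piMr// ger0_norm indicE// ?lern1 ?leq_b1//.
- move=> x; apply: cvg_near_cst; near=> n.
  rewrite indicE mem_set ?mulr1// /D /= in_itv /=; apply/andP.
  suff : `|x| < n%:R by rewrite ltr_norml => /andP[-> /ltW ->].
  by near: n; exact: nbhs_infty_gtr.
- move=> n.
  have -> : (fun x => f x * \1_(D n) x) = (fun x => \sum_(y <- finmap.enum_fset (fset_set (range f)))
      y * \1_(f @^-1` [set y] `&` D n) x).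
    apply/funext => x; rewrite fimfunE fsbig_finite//= mulr_suml.
    apply: eq_bigr => y _; rewrite -mulrA; congr (_ * _).
    by rewrite indicI.
  have M_sum r : mu.-integrable setT (EFin \o (fun x => \sum_(y <- r)
        y * \1_(f @^-1` [set y] `&` D n) x)) /\
      M (L1_of mu (fun x => \sum_(y <- r) y * \1_(f @^-1` [set y] `&` D n) x)).
    elim: r => [|y r [intr Mr]].
      under eq_fun do rewrite big_nil.
      rewrite (_ : (fun=> 0) = \1_(set0 `&` D n)); last by rewrite set0I indic0.
      by split; [exact: integrable_D|exact: M_indicD].
    have mf : measurable (f @^-1` [set y]) by [].
    under eq_fun do rewrite big_cons.
    split; first by apply: integrableR_linear => //; exact: integrable_D.
    by rewrite L1_of_linear//; [apply: M_linear => //; exact: M_indicD|exact: integrable_D].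
  by have [] := M_sum (finmap.enum_fset (fset_set (range f))).
Unshelve. all: by end_near. Qed.

Lemma L1_itv_dense F : M F.
Proof.
rewrite -[F]L1_ofK; have intF := L1_integrable F.
have [g [intg _ gF]] := approximation_sfun_integrable measurableT intF.
apply: (closed_cvg (fun F => M F)) (@L1_of_cvg _ _ _ _ g _ intg intF _) => //.
  by apply: nearW => n; exact: M_sfun.
apply: cvg_trans gF; apply: near_eq_cvg; apply: nearW => n.
by apply: eq_integral => x _; exact: (congr1 EFin (distrC _ _)).
Qed.

End DenseSubspace.
End LebesgueL1.

(** * Step functions: an isometric copy of the line in L^1 *)

Section StepElements.
Context {R : realType}.
Notation mu := (@lebesgue_measure R).
Notation L1 := (LspaceType1 mu).

(* [step y] is the oriented indicator of the interval between [0] and [y]. *)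
Definition step (y x : R) : R := (x <= y)%R%:R - (x <= 0)%R%:R.

Lemma step0 x : step 0 x = 0.
Proof. exact: subrr. Qed.

Lemma stepB a b x : a <= b -> step b x - step a x = \1_(`]a, b]%classic) x.
Proof.
move=> ab; rewrite /step indicE opprD addrACA opprK addNr addr0.
have -> : (x \in `]a, b]%classic) = (a < x <= b) by rewrite mem_setE in_itv.
have [xa|ax] := leP x a; first by rewrite (le_trans xa ab) subrr.
by rewrite subr0.
Qed.

Lemma integrable_step y : mu.-integrable setT (EFin \o step y).
Proof.
pose c : R := (0 <= y)%R%:R; pose c' : R := (y < 0)%R%:R.
(* One formula for both signs: [c'] is 0 when [y >= 0], and the interval []0, y]] is empty when
   [y < 0]. *)
have -> : step y = (fun x => - c' * \1_(`]y, 0]%classic) x + 1 * \1_(`]0, y]%classic) x).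
  apply/funext => x; have [y0|y0] := leP 0 y.
    by rewrite /c' ltNge y0 oppr0 mul0r add0r mul1r -stepB// step0 subr0.
  rewrite /c' y0 mulN1r -stepB ?(ltW y0)// step0 sub0r opprK.
  by rewrite set_itv_ge ?bnd_simp -?leNgt ?(ltW y0)// indic0 mulr0 addr0.
apply: integrableR_linear; first exact: integrable_indic_itv.
rewrite (_ : (fun x => _) = \1_(`]0, y]%classic)); first exact: integrable_indic_itv.
by apply/funext => x; rewrite mul1r.
Qed.

Definition L1_step (y : R) : L1 := L1_of mu (step y).

Lemma L1_step0 : L1_step 0 = 0.
Proof.
apply/normr0_eq0; rewrite norm_L1_of; last exact: integrable_step.
under eq_Rintegral do rewrite step0 normr0.
by rewrite /Rintegral integral0.
Qed.

Lemma L1_stepB a b : a <= b -> L1_step b - L1_step a = L1_of mu (\1_(`]a, b]%classic)).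
Proof.
move=> ab; rewrite -L1_ofB; [|exact: integrable_step..].
by congr L1_of; apply/funext => x; exact: stepB.
Qed.

Lemma norm_L1_stepB a b : a <= b -> `|L1_step b - L1_step a| = b - a.
Proof.
move=> ab; rewrite L1_stepB// norm_L1_of; last exact: integrable_indic_itv.
under eq_Rintegral do rewrite ger0_norm//.
have muab : mu `]a, b]%classic = (b - a)%:E.
  rewrite lebesgue_measure_itv /= lte_fin.
  by move: ab; rewrite le_eqVlt => /orP[/eqP->|->//]; rewrite ltxx subrr.
by rewrite /Rintegral integral_indic// setIT [X in fine X]muab.
Qed.

Lemma norm_L1_step y : `|L1_step y| = `|y|.
Proof.
have [y0|y0] := leP 0 y.
  by rewrite -[L1_step y]subr0 -L1_step0 norm_L1_stepB// subr0 ger0_norm.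
rewrite -normrN -[- _]add0r -L1_step0 norm_L1_stepB ?(ltW y0)//.
by rewrite sub0r ltr0_norm.
Qed.

Section LipschitzFunctional.
Variables (G : R -> R) (K : R).
Hypothesis G_lip : forall x y, `|G x - G y| <= K * `|x - y|.

Let K0 : 0 <= K.
Proof. by have := le_trans (normr_ge0 _) (G_lip 1 0); rewrite subr0 normr1 mulr1. Qed.

Let continuous_G : continuous G.
Proof.
move=> x; apply/cvgrPdist_lt => e e0.
have K1 : 0 < K + 1 by rewrite ltr_wpDl.
have /cvgrPdist_lt/(_ _ (divr_gt0 e0 K1)) : y @[y --> x] --> x by exact: cvg_id.
apply: filterS => y xy.
rewrite (le_lt_trans (G_lip _ _))// (@le_lt_trans _ _ ((K + 1) * `|x - y|))//.
  by rewrite ler_wpM2r// lerDl.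
by rewrite mulrC -ltr_pdivlMr.
Qed.

Let continuous_quotient (h : R) : continuous (fun x => (G (x + h) - G x) / h).
Proof.
move=> x; apply: cvgM; last exact: cvg_cst.
apply: cvgB; last exact: continuous_G.
apply: (@continuous_comp _ _ _ (fun x => x + h) G); last exact: continuous_G.
by apply: cvgD; [exact: cvg_id|exact: cvg_cst].
Qed.

(** The quotient is the derivative of [B], the mean of [G] over [[x, x + h]]. This mean is within
    [K * h] of [G x], and the two endpoints give [2 * K * h]. *)
Lemma Rintegral_difference_quotient (a b h : R) : a < b -> 0 < h ->
  `|\int[mu]_(x in `[a, b]) ((G (x + h) - G x) / h) - (G b - G a)| <= 2 * K * h.
Proof.
move=> ab h0.
(* The primitive starts at [a - 1], so that [a] is an interior point and derivatives there are
   two-sided. *)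
pose A x := \int[mu]_(t in `[a - 1, x]) G t.
have dA x : a - 1 < x -> is_derive x 1 A (G x).
  move=> ax; have xx1 : x < x + 1 by rewrite ltrDl.
  have [|||dA A'] := @continuous_FTC1_closed _ G (a - 1) x (x + 1) xx1.
  - apply: continuous_compact_integrable; first exact: segment_compact.
    by apply: continuous_subspaceT => z; exact: continuous_G.
  - exact: ax.
  - exact: continuous_G.
  - by apply: (DeriveDef dA); rewrite -A' derive1E.
pose B x := (A (x + h) - A x) / h.
have dB x : a - 1 < x -> is_derive x 1 B ((G (x + h) - G x) / h).
  move=> ax; have axh : a - 1 < x + h by rewrite (lt_le_trans ax)// lerDl ltW.
  have dAh : is_derive (shift h x) 1 A (G (x + h)) := dA _ axh.
  have dAs := is_derive1_comp dAh (is_derive_shift x 1 h).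
  have -> : B = h^-1 *: ((A \o shift h) - A).
    by apply/funext => y; rewrite /B mulrC.
  rewrite mulrC -[G (x + h)]mulr1.
  exact: (is_deriveZ _ (is_deriveB dAs (dA x ax))).
have cB x : a - 1 < x -> {for x, continuous B}.
  by move=> /dB[dBx _]; apply: differentiable_continuous; exact/derivable1_diffP.
have BG x : a <= x -> `|B x - G x| <= K * h.
  move=> ax.
  have [|||c] := @MVT _ A G x (x + h).
  - by rewrite ltrDl.
  - move=> y; rewrite in_itv /= => /andP[xy _]; apply: dA.
    by rewrite (lt_trans _ xy)// (lt_le_trans _ ax)// gtrBl.
  - apply: derivable_within_continuous => y; rewrite in_itv /= => /andP[xy _].
    by have [] := dA y; first lra.
  rewrite in_itv /= => /andP[xc cxh] AE.
  rewrite /B AE addrAC subrr add0r mulfK ?gt_eqF// (le_trans (G_lip _ _))//.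
  by rewrite ler_wpM2l// ger0_norm ?subr_ge0 ?(ltW xc)// lerBlDl ltW.
have -> : \int[mu]_(x in `[a, b]) ((G (x + h) - G x) / h) = B b - B a.
  rewrite /Rintegral (@continuous_FTC2 _ _ B a b)//.
  - by apply: continuous_subspaceT; exact: continuous_quotient.
  - split.
    + by move=> x; rewrite in_itv /= => /andP[ax _]; have [] := dB x; first lra.
    + apply: cvg_at_right_filter; apply: cB; lra.
    + apply: cvg_at_left_filter; apply: cB; lra.
  - move=> x; rewrite in_itv /= => /andP[ax _].
    by rewrite derive1E; have [] := dB x; first lra.
have -> : B b - B a - (G b - G a) = (B b - G b) - (B a - G a) by ring.
rewrite (le_trans (ler_normB _ _))// -mulrA mulr2n mulrDl mul1r.
by rewrite lerD// BG// ltW.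
Qed.

(* [J] integrates against the difference quotients of [G], which are bounded by
   [K]; no almost everywhere derivative of [G] is needed. *)
Lemma L1_step_functional e : 0 < e -> G 0 = 0 ->
  exists2 J : {linear L1 -> R^o}, (forall F, `|J F| <= K * `|F|) &
    forall y, `|J (L1_step y) - G y| <= e.
Proof.
(* The added 1 keeps the denominator positive when [K = 0]. *)
move=> e0 G0; pose h := e / (2 * K + 1).
have K1 : 0 < 2 * K + 1 by rewrite ltr_wpDl// mulr_ge0.
have h0 : 0 < h by rewrite divr_gt0.
have he : 2 * K * h <= e.
  by rewrite -[leRHS](divfK (lt0r_neq0 K1)) -/h mulrC ler_wpM2l ?(ltW h0)// lerDl.
pose g x := (G (x + h) - G x) / h.
have mg : measurable_fun setT (g : measurableTypeR R -> R).
  by apply: continuous_measurable_fun; exact: continuous_quotient.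
have gK x : `|g x| <= K.
  rewrite normrM normfV (gtr0_norm h0) ler_pdivrMr// (le_trans (G_lip _ _))//.
  by rewrite addrAC subrr add0r gtr0_norm.
have [J JE JK] := L1_pairing mu mg gK; exists J => // y.
have J_itv a b : a < b -> `|J (L1_step b) - J (L1_step a) - (G b - G a)| <= e.
  move=> ab; rewrite -linearB L1_stepB ?(ltW ab)// JE.
  have int1 := integrable_indic_itv a b false false.
  rewrite (@ae_eq_Rintegral _ (measurableTypeR R) R mu _ (fun x => g x * \1_(`]a, b]%classic) x)).
  - apply: le_trans he; rewrite (le_trans _ (Rintegral_difference_quotient ab h0))//.
    rewrite -Rintegral_itv_obnd_cbnd; last first.
      have intab : mu.-integrable `[a, b]%classic (EFin \o g).
        apply: continuous_compact_integrable; first exact: segment_compact.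
        by apply: continuous_subspaceT; exact: continuous_quotient.
      by apply: integrableS intab => //; apply: subset_itvr; rewrite bnd_simp.
    rewrite [in leRHS]Rintegral_mkcond.
    rewrite le_eqVlt; apply/orP; left; apply/eqP; congr (`|_ - _|); apply: eq_Rintegral => x _.
    by rewrite patchE indicE; case: ifP; rewrite /= ?mulr1 ?mulr0.
  - exact: integrableR_measurable (integrableR_mul mg gK (L1_integrable _)).
  - exact: integrableR_measurable (integrableR_mul mg gK int1).
  - by apply: filterS (L1_ofP int1) => x /(_ Logic.I) -> _.
have [y0|y0|<-] := ltgtP 0 y; last by rewrite L1_step0 linear0 G0 subrr normr0 ltW.
  by have := J_itv _ _ y0; rewrite L1_step0 linear0 G0 !subr0.
have := J_itv _ _ y0; rewrite L1_step0 linear0 G0 !sub0r -normrN.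
by rewrite opprD !opprK.
Qed.

End LipschitzFunctional.
End StepElements.

(** * The cusp *)

Section CuspScale.
Context {R : realType}.
Implicit Types x y t : R.

(** Its derivative is [(2x + 1) exp(-1/x)], to be compared with [(h' + h/x^2) exp(-1/x)], the
    derivative of [h exp(-1/x)]. The estimates below are difference forms of this comparison. *)
Definition cusp_scale x := x ^+ 2 * expR (- x^-1).

Lemma cusp_scale_gt0 x : 0 < x -> 0 < cusp_scale x.
Proof. by move=> x0; rewrite mulr_gt0 ?exprn_gt0 ?expR_gt0. Qed.

Lemma expR_scale x : expR (x^-1) * cusp_scale x = x ^+ 2.
Proof. by rewrite mulrCA -expRD subrr expR0 mulr1. Qed.

Lemma expR_inv_ge x y : 0 < y -> y <= x ->
  expR (- y^-1) * (1 + (y^-1 - x^-1)) <= expR (- x^-1).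
Proof.
move=> y0 yx; rewrite [X in _ <= expR X](_ : _ = - y^-1 + (y^-1 - x^-1)); last by ring.
by rewrite expRD ler_wpM2l ?expR_ge0 ?expR_ge1Dx.
Qed.

Lemma expR_inv_le x y : 0 < y -> y <= x -> expR (- y^-1) <= expR (- x^-1).
Proof.
by move=> y0 yx; rewrite ler_expR lerN2 lef_pV2 ?posrE// (lt_le_trans y0).
Qed.

Lemma cusp_scaleB x y : 0 < y -> y <= x ->
  cusp_scale x - cusp_scale y =
  x ^+ 2 * (expR (- x^-1) - expR (- y^-1)) + (x ^+ 2 - y ^+ 2) * expR (- y^-1).
Proof. by move=> y0 yx; rewrite /cusp_scale; ring. Qed.

(** Difference form of [x^2 (exp(-1/x))' = exp(-1/x)]: convexity of the exponential leaves
    [x^2 (1/y - 1/x) = (x - y) x / y], which is at least [x - y]. *)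
Lemma cusp_scaleB_ge x y : 0 < y -> y <= x ->
  (x - y) * expR (- y^-1) <= x ^+ 2 * (expR (- x^-1) - expR (- y^-1)).
Proof.
move=> y0 yx; have x0 := lt_le_trans y0 yx.
have e_gt0 := expR_gt0 (- y^-1).
apply: (@le_trans _ _ (x ^+ 2 * (expR (- y^-1) * (y^-1 - x^-1)))); last first.
  rewrite ler_wpM2l ?sqr_ge0//; have := expR_inv_ge y0 yx; lra.
rewrite mulrCA mulrC ler_wpM2l ?(ltW e_gt0)//.
have -> : x ^+ 2 * (y^-1 - x^-1) = (x - y) * (x / y) by field; rewrite !gt_eqF.
by rewrite ler_peMr ?subr_ge0// ler_pdivlMr// mul1r.
Qed.

Lemma cusp_scale_le x y : 0 < y -> y <= x -> cusp_scale y <= cusp_scale x.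
Proof.
move=> y0 yx; rewrite -subr_ge0 cusp_scaleB// addr_ge0//.
  apply: le_trans (cusp_scaleB_ge y0 yx).
  by rewrite mulr_ge0 ?subr_ge0 ?expR_ge0.
by rewrite mulr_ge0 ?expR_ge0// subr_ge0 lerXn2r ?nnegrE ?(le_trans (ltW y0)) ?(ltW y0).
Qed.

Lemma cusp_scale_surj t : 0 < t -> exists2 x, 0 < x & cusp_scale x = t.
Proof.
(* Intermediate values on [[min(1, t), 1 + t]]: at the left end the function is at most [lo], at the
   right end at least [(1 + t)^2 (1 - 1/(1 + t)) = t + t^2]. *)
move=> t0; pose lo := Num.min 1 t.
have lo0 : 0 < lo by rewrite lt_min ltr01.
have lo_hi : lo <= 1 + t by rewrite ge_min lerDl ltW.
have mlo : cusp_scale lo <= t.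
  apply: (@le_trans _ _ lo); last by rewrite ge_min lexx orbT.
  rewrite /cusp_scale expr2 -mulrA ler_piMr ?(ltW lo0)//.
  rewrite mulr_ile1 ?(ltW lo0) ?expR_ge0 ?ge_min ?lexx//.
  by rewrite -[leRHS]expR0 ler_expR oppr_le0 invr_ge0 ltW.
have mhi : t <= cusp_scale (1 + t).
  have t1 : 0 < 1 + t by rewrite addr_gt0.
  apply: (@le_trans _ _ ((1 + t) ^+ 2 * (1 - (1 + t)^-1))).
    have -> : (1 + t) ^+ 2 * (1 - (1 + t)^-1) = t + t * t by field; rewrite gt_eqF.
    by rewrite lerDl mulr_ge0 ?ltW.
  by rewrite ler_wpM2l ?sqr_ge0 ?expR_ge1Dx.
have cm : {within `[lo, 1 + t], continuous cusp_scale}.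
  apply: continuous_in_subspaceT => x; rewrite mem_setE in_itv /= => /andP[lox _].
  have x0 : x != 0 by rewrite gt_eqF// (lt_le_trans lo0).
  apply: (@continuousM _ _ (fun x => x ^+ 2) (fun x => expR (- x^-1))).
    exact: exprn_continuous.
  apply: (@continuous_comp _ _ _ (fun x : R => - x^-1) expR); last exact: continuous_expR.
  by apply: continuousN; exact: inv_continuous.
have [|x] := @IVT _ cusp_scale lo (1 + t) t lo_hi cm.
  by rewrite ge_min mlo /= le_max mhi orbT.
by rewrite in_itv /= => /andP[lox _] mx; exists x => //; exact: lt_le_trans lox.
Qed.

End CuspScale.

(** * Parametrisation of the two branches and distances *)

Section CuspPoints.
Context {R : realType}.
Implicit Types (x y : R) (p q : Cusp R).

Lemma lower_in x : (`|x|, 0) \in @cusp_set R.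
Proof. by apply/mem_set; left; exists `|x| => //=. Qed.

Lemma upper_in x : (`|x|, `|x| ^+ 2) \in @cusp_set R.
Proof. by apply/mem_set; right; exists `|x| => //=. Qed.

(** The absolute value makes both parametrisations total on the line; opposite parameters give the
    same point. *)
Definition lower x : Cusp R := MkEuclideanSubset (lower_in x).
Definition upper x : Cusp R := MkEuclideanSubset (upper_in x).

Lemma cuspP p : exists2 x, 0 <= x & p = lower x \/ p = upper x.
Proof.
have /set_mem[[x /= x0 xp]|[x /= x0 xp]] := valP p; exists x => //.
  by left; apply/val_inj; rewrite /= -xp ger0_norm.
by right; apply/val_inj; rewrite /= -xp ger0_norm.
Qed.

Lemma cusp_dist_ge1 p q : `|p.1 - q.1| <= mdist p q.
Proof.
by rewrite -sqrtr_sqr ler_wsqrtr// lerDl sqr_ge0.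
Qed.

Lemma cusp_dist_ge2 p q : `|p.2 - q.2| <= mdist p q.
Proof. by rewrite -sqrtr_sqr ler_wsqrtr// lerDr sqr_ge0. Qed.

Lemma cusp_dist_le p q : mdist p q <= `|p.1 - q.1| + `|p.2 - q.2|.
Proof.
rewrite -[leRHS]ger0_norm ?addr_ge0// -sqrtr_sqr ler_wsqrtr//.
rewrite [leRHS]sqrrD !real_normK ?num_real// [leRHS]addrAC lerDl.
by rewrite mulrn_wge0// mulr_ge0.
Qed.

End CuspPoints.

Lemma scaler_subE (R : pzRingType) (V : lmodType R) (a b : R) (u v : V) :
  a *: u - b *: v = a *: (u - v) - (b - a) *: v.
Proof. by rewrite scalerBr scalerBl opprB addrA subrK. Qed.

Lemma subr_subACA (V : zmodType) (a b c d : V) : a - b - (c - d) = (d - b) + (a - c).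
Proof. by rewrite opprB addrACA [a + d]addrC addrACA. Qed.

Lemma subr_subKA (V : zmodType) (a b c : V) : (a - c) - (b - c) = a - b.
Proof. by rewrite opprB addrA subrK. Qed.

(** * Embedding of the cusp into L^1 *)

Section CuspEmbedding.
Context {R : realType}.
Notation mu := (@lebesgue_measure R).
Notation L1 := (LspaceType1 mu).
Implicit Types (x y : R) (p q : Cusp R).

(** The second coordinate enters as [b], which treats both branches at once: [b = 0] gives 0, and
    [b = x^2] gives height [exp(1/x)] on []0, cusp_scale x]] for [x > 0]. *)
Definition spike x b : L1 := expR (x^-1) *: L1_step (b * expR (- x^-1)).

(* Image of the evaluation at [p], up to the constant fixing the base point. The
   convention [0^-1 = 0] makes it vanish at the vertex. *)
Definition cusp_step p : L1 := spike p.1 p.2 - L1_step (- p.1).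

Lemma norm_L1_step_dist x y : `|L1_step x - L1_step y| = `|x - y| :> R.
Proof.
have [xy|/ltW xy] := leP y x; first by rewrite norm_L1_stepB// ger0_norm ?subr_ge0.
by rewrite distrC norm_L1_stepB// distrC ger0_norm ?subr_ge0.
Qed.

Lemma spike0 x : spike x 0 = 0.
Proof. by rewrite /spike mul0r L1_step0 scaler0. Qed.

Lemma norm_spike x b : `|spike x b| = `|b|.
Proof.
rewrite normrZ norm_L1_step normrM !(gtr0_norm (expR_gt0 _)) mulrCA -expRD.
by rewrite subrr expR0 mulr1.
Qed.

(** Splitting off the common height [P] bounds the norm by [x^2 + y^2 - 2 P cusp_scale(y)].
    Convexity of the exponential bounds the last product below, with a slack of
    [2 (x - y)^2 / x]. *)
Lemma spike_lip x y : 0 < y -> y <= x ->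
  `|spike x (x ^+ 2) - spike y (y ^+ 2)| <= x ^+ 2 - y ^+ 2 + 2 * (x - y).
Proof.
move=> y0 yx; have x0 := lt_le_trans y0 yx.
rewrite /spike -!/(cusp_scale _).
set P := expR (x^-1); set Q := expR (y^-1).
rewrite scaler_subE.
rewrite (le_trans (ler_normB _ _))// !normrZ norm_L1_stepB ?cusp_scale_le//.
rewrite norm_L1_step [`|cusp_scale y|]gtr0_norm ?cusp_scale_gt0//.
rewrite gtr0_norm ?expR_gt0// ger0_norm; last first.
  by rewrite subr_ge0 ler_expR lef_pV2 ?posrE.
rewrite mulrBr mulrBl !expR_scale.
have Pm : y ^+ 2 * (1 + (x^-1 - y^-1)) <= P * cusp_scale y.
  rewrite mulrCA ler_wpM2l ?sqr_ge0// -expRD.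
  exact: expR_ge1Dx.
have : 2 * (y ^+ 2 * (1 + (x^-1 - y^-1))) >= 2 * y ^+ 2 - 2 * (x - y).
  rewrite -subr_ge0 (_ : _ - _ = 2 * ((x - y) ^+ 2 / x)); last by field; rewrite !gt_eqF.
  by rewrite mulr_ge0// divr_ge0 ?sqr_ge0 ?ltW.
lra.
Qed.

Lemma cusp_step_lip p q : `|cusp_step p - cusp_step q| <= 4 * mdist p q.
Proof.
wlog qp : p q / q.1 <= p.1.
  move=> H; have [|/ltW] := leP q.1 p.1; first exact: H.
  by rewrite distrC metric_sym; exact: H.
have d1 := cusp_dist_ge1 p q; have d2 := cusp_dist_ge2 p q.
have d_le : mdist p q <= 3 * mdist p q by rewrite ler_peMl ?mdist_ge0// ler1n.
rewrite /cusp_step subr_subACA.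
rewrite (le_trans (ler_normD _ _))//.
(* One unit pays for the lower-branch part; three pay for the spikes, namely one for [x^2 - y^2] and
   two for [2 (x - y)]. *)
rewrite [leRHS](_ : _ = mdist p q + 3 * mdist p q); last by ring.
rewrite lerD//; first by rewrite norm_L1_step_dist opprK addrC.
have [x x0 [pE|pE]] := cuspP p; have [y y0 [qE|qE]] := cuspP q;
  rewrite {}pE {}qE in qp d1 d2 d_le *; rewrite /= ?spike0 ?subr0 ?sub0r ?normrN.
- by rewrite normr0 (le_trans _ d_le)// mdist_ge0.
- by rewrite norm_spike (le_trans _ d_le)// (le_trans _ d2)//= sub0r normrN.
- by rewrite norm_spike (le_trans _ d_le)// (le_trans _ d2)//= subr0.
(* [spike_lip] needs [y > 0]; at the vertex the second spike vanishes and the first has norm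
   [x^2]. *)
have [y_eq0|y_neq0] := eqVneq y 0.
  rewrite y_eq0 normr0 expr0n spike0 subr0 norm_spike -y_eq0.
  by rewrite (le_trans _ d_le)// (le_trans _ d2)//= y_eq0 normr0 expr0n subr0.
rewrite (le_trans (spike_lip _ _)) ?normr_gt0//.
have := le_trans (ler_norm _) d1; have := le_trans (ler_norm _) d2 => /=; lra.
Qed.

(** * Unfolding a Lipschitz function on the cusp to the line *)

Section Approximation.
Context (x0 : Cusp R) (f : Lip0 x0).
Local Notation L := `|f|.

Let f_lip p q : `|f p - f q| <= L * mdist p q.
Proof. exact: Lip0_normP. Qed.

(* [gap] is bounded by the distance [x ^+ 2] between the two branches: this is
   what makes the rescaling of [gap] Lipschitz in the variable [cusp_scale]. *)
Definition gap x : R := f (upper x) - f (lower x).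

Lemma gap_le x : `|gap x| <= L * x ^+ 2.
Proof.
rewrite (le_trans (f_lip _ _))// ler_wpM2l//.
rewrite (le_trans (cusp_dist_le _ _))//= subrr normr0 add0r subr0.
by rewrite normrX normr_id -normrX ger0_norm ?sqr_ge0.
Qed.

Lemma lower_lip x y : `|f (lower x) - f (lower y)| <= L * `|x - y|.
Proof.
rewrite (le_trans (f_lip _ _))// ler_wpM2l//.
rewrite (le_trans (cusp_dist_le _ _))//= subrr normr0 addr0.
exact: ler_dist_dist.
Qed.

Lemma gap_lip x y : 0 < y -> y <= x ->
  `|gap x - gap y| <= L * (2 * (x - y) + (x ^+ 2 - y ^+ 2)).
Proof.
move=> y0 yx; have x_gt0 := lt_le_trans y0 yx.
have -> : gap x - gap y = (f (upper x) - f (upper y)) - (f (lower x) - f (lower y)).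
  by rewrite /gap; ring.
have xy : `|x - y| = x - y by rewrite ger0_norm ?subr_ge0.
rewrite (le_trans (ler_normB _ _))//.
have := lower_lip x y; rewrite xy.
suff : `|f (upper x) - f (upper y)| <= L * ((x - y) + (x ^+ 2 - y ^+ 2)) by lra.
rewrite (le_trans (f_lip _ _))// ler_wpM2l//.
rewrite (le_trans (cusp_dist_le _ _))//= (gtr0_norm x_gt0) (gtr0_norm y0) xy lerD2l.
by rewrite ger0_norm// subr_ge0 lerXn2r ?nnegrE ?(ltW x_gt0) ?(ltW y0).
Qed.

(** A discrete product rule. The constant 3 is 1 from [gap_le] plus 2 from the term [2 (x - y)] of
    [gap_lip], which [cusp_scaleB_ge] absorbs. *)
Lemma scaled_gap_lip x y : 0 < y -> y <= x ->
  `|gap x * expR (- x^-1) - gap y * expR (- y^-1)| <=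
    3 * L * (cusp_scale x - cusp_scale y).
Proof.
move=> y0 yx; have x_gt0 := lt_le_trans y0 yx.
have qq := expR_inv_le y0 yx; have q_ge0 := expR_ge0 (- y^-1).
have mB := cusp_scaleB y0 yx; have mB_ge := cusp_scaleB_ge y0 yx.
have -> : gap x * expR (- x^-1) - gap y * expR (- y^-1) =
  gap x * (expR (- x^-1) - expR (- y^-1)) + (gap x - gap y) * expR (- y^-1) by ring.
rewrite (le_trans (ler_normD _ _))// !normrM (ger0_norm q_ge0).
rewrite [`|expR _ - _|]ger0_norm ?subr_ge0//.
apply: (@le_trans _ _ (L * x ^+ 2 * (expR (- x^-1) - expR (- y^-1)) +
   L * (2 * (x - y) + (x ^+ 2 - y ^+ 2)) * expR (- y^-1))).
  by rewrite lerD// ler_wpM2r ?subr_ge0 ?gap_le ?gap_lip.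
have xy2 : 0 <= (x ^+ 2 - y ^+ 2) * expR (- y^-1).
  by rewrite mulr_ge0// subr_ge0 lerXn2r ?nnegrE ?(ltW x_gt0) ?(ltW y0).
rewrite [3 * L]mulrC -!mulrA -mulrDr ler_wpM2l// mB.
by nra.
Qed.

(** [G] is glued at 0 from the lower branch, with reversed sign and orientation, and the rescaled
    gap; across 0 the Lipschitz bound adds the bounds [G_neg] and [G_pos]. *)
Lemma cusp_unfolding : exists G : R -> R, [/\
  forall x y, `|G x - G y| <= 3 * L * `|x - y|, G 0 = 0,
  forall x, 0 <= x -> G (- x) = f (lower 0) - f (lower x) &
  forall x, 0 < x -> G (cusp_scale x) = gap x * expR (- x^-1)].
Proof.
have /choice[m mP] t : exists x, 0 < t -> 0 < x /\ cusp_scale x = t.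
  have [t0|_] := ltP 0 t; last by exists 0.
  by have [x] := cusp_scale_surj t0; exists x.
pose D x := gap x * expR (- x^-1).
have D_lip x y : 0 < x -> 0 < y ->
    `|D x - D y| <= 3 * L * `|cusp_scale x - cusp_scale y|.
  wlog yx : x y / y <= x.
    move=> H x_gt0 y_gt0; have [yx|/ltW xy] := leP y x; first exact: H.
    by rewrite distrC [`|cusp_scale _ - _|]distrC; exact: H.
  move=> _ y_gt0; rewrite [leRHS](_ : _ = 3 * L * (cusp_scale x - cusp_scale y)).
    exact: scaled_gap_lip.
  by rewrite ger0_norm// subr_ge0 cusp_scale_le.
have D_le x : 0 < x -> `|D x| <= L * cusp_scale x.
  move=> x_gt0; rewrite normrM (gtr0_norm (expR_gt0 _)) mulrA.
  by rewrite ler_wpM2r ?expR_ge0 ?gap_le.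
pose G t := if t <= 0 then f (lower 0) - f (lower t) else D (m t).
have G_neg t : t <= 0 -> `|G t| <= L * - t.
  move=> t0; rewrite /G t0 (le_trans (lower_lip _ _))//.
  by rewrite sub0r normrN ler0_norm.
have G_pos t : 0 < t -> `|G t| <= L * t.
  move=> t0; rewrite /G (lt_geF t0); have [mt mE] := mP _ t0.
  by rewrite -[in leRHS]mE; exact: D_le.
have L3 : L <= 3 * L by rewrite ler_peMl// ler1n.
exists G; split.
- move=> s t; wlog st : s t / s <= t.
    move=> H; have [|/ltW] := leP s t; first exact: H.
    by rewrite distrC [`|s - t|]distrC; exact: H.
  have [t0|t0] := leP t 0.
    rewrite /G (le_trans st t0) t0.
    have -> : f (lower 0) - f (lower s) - (f (lower 0) - f (lower t)) =
      f (lower t) - f (lower s) by ring.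
    by rewrite (le_trans (lower_lip _ _))// distrC ler_wpM2r.
  have [s0|s0] := leP s 0.
    rewrite (le_trans (ler_normB _ _))//.
    apply: (@le_trans _ _ (L * - s + L * t)); first by rewrite lerD ?G_neg ?G_pos.
    have -> : `|s - t| = - s + t by rewrite ler0_norm ?subr_le0// opprB addrC.
    by rewrite -mulrDr ler_wpM2r// addr_ge0 ?oppr_ge0// ltW.
  rewrite /G (lt_geF s0) (lt_geF t0).
  have [ms0 msE] := mP _ s0; have [mt0 mtE] := mP _ t0.
  by have := D_lip _ _ ms0 mt0; rewrite msE mtE.
- by rewrite /G lexx subrr.
- move=> x x_ge0; rewrite /G oppr_le0 x_ge0.
  by congr (_ - f _); apply/val_inj; rewrite /= normrN.
- move=> x x_gt0; have m0 := cusp_scale_gt0 x_gt0.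
  rewrite /G (lt_geF m0); have [mx mE] := mP _ m0.
  (* By [D_lip], [D x] depends only on [cusp_scale x], so the preimage chosen by [m] does not affect
     the value. *)
  apply/eqP; rewrite -subr_eq0 -normr_le0 (le_trans (D_lip _ _ mx x_gt0))//.
  by rewrite mE subrr normr0 mulr0.
Qed.

End Approximation.

(** * Approximating functionals and density of the span *)

Lemma cusp_step_lower x : 0 <= x -> cusp_step (lower x) = - L1_step (- x).
Proof. by move=> x0; rewrite /cusp_step /= spike0 sub0r ger0_norm. Qed.

Lemma cusp_step_upper x : 0 <= x ->
  cusp_step (upper x) =
  expR (x^-1) *: L1_step (cusp_scale x) + cusp_step (lower x).
Proof.
by move=> x0; rewrite (cusp_step_lower x0) /cusp_step /= ger0_norm.
Qed.

(** The functional attached to [G] recovers [f] up to [e] on the lower branch; on the upper one the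
    height [exp(1/x)] multiplies a second error, whence a weight depending on [p]. *)
Lemma cusp_step_approx (x0 : Cusp R) (f : Lip0 x0) e : 0 < e ->
  exists2 J : {linear L1 -> R^o}, (forall F, `|J F| <= 3 * `|f| * `|F|) &
  forall p, `|J (cusp_step p) - (f p - f (lower 0))| <= (1 + expR (p.1)^-1) * e.
Proof.
move=> e0; have [G [G_lip G0 G_lower G_upper]] := cusp_unfolding f.
have [J J_le J_step] := L1_step_functional G_lip e0 G0; exists J => // p.
have J_lower x : 0 <= x -> `|J (cusp_step (lower x)) - (f (lower x) - f (lower 0))| <= e.
  move=> x_ge0; rewrite cusp_step_lower// linearN -opprD normrN.
  have -> : J (L1_step (- x)) + (f (lower x) - f (lower 0)) =
    J (L1_step (- x)) - G (- x) by rewrite G_lower// opprB.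
  exact: J_step.
have [x x_ge0 pE] := cuspP p.
have e_le : e <= (1 + expR (p.1)^-1) * e by rewrite ler_peMl ?(ltW e0)// lerDl expR_ge0.
(* The vertex lies on both branches and is treated as a lower point, since [G_upper] requires
   [x > 0]. *)
have [x_eq0|x_neq0] := eqVneq x 0.
  have -> : p = lower 0.
    by case: pE => ->; rewrite x_eq0//; apply/val_inj; rewrite /= normr0 expr0n.
  by rewrite (le_trans (J_lower _ _))// ler_peMl ?(ltW e0)// lerDl expR_ge0.
have x_gt0 : 0 < x by rewrite lt_def x_neq0.
case: pE => pE; first by rewrite (le_trans _ e_le)// pE J_lower.
rewrite pE /= (ger0_norm x_ge0) cusp_step_upper// linearD linearZ /=.
have -> : expR x^-1 * J (L1_step (cusp_scale x)) + J (cusp_step (lower x)) -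
    (f (upper x) - f (lower 0)) =
  (J (cusp_step (lower x)) - (f (lower x) - f (lower 0))) +
  expR x^-1 * (J (L1_step (cusp_scale x)) - G (cusp_scale x)).
  rewrite G_upper// mulrBr mulrCA -expRD subrr expR0 mulr1 /gap; ring.
rewrite (le_trans (ler_normD _ _))// mulrDl mul1r lerD ?J_lower//.
by rewrite normrM (gtr0_norm (expR_gt0 _)) ler_wpM2l ?expR_ge0.
Qed.

(** Every step element lies in the closed span: lower points give [y <= 0]; rescaled differences of
    the branches give [y > 0], since [cusp_scale] is onto. *)
Lemma cusp_step_dense (x0 : Cusp R) (F : L1) :
  closure (linear_span (range (fun p => cusp_step p - cusp_step x0))) F.
Proof.
set w := fun p => cusp_step p - cusp_step x0.
have [M0 M_lin] := closed_span_submod_closed (range w).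
have span_w p : closure (linear_span (range w)) (w p).
  apply: subset_closure; rewrite linear_span_comb; exists [:: (1, p)] => //.
  by rewrite /comb big_seq1 scale1r.
pose M := closure (linear_span (range w)).
have {}M_lin a u v : M u -> M v -> M (a *: u + v).
  by move=> /mem_set Mu /mem_set Mv; apply/set_mem/M_lin.
have {}M0 : M 0 by exact/set_mem.
have M_sub u v : M u -> M v -> M (u - v).
  by move=> Mu Mv; rewrite addrC -scaleN1r; exact: M_lin.
have M_scale a u : M u -> M (a *: u).
  by move=> Mu; rewrite -[_ *: _]addr0; exact: M_lin.
have M_lower x : 0 <= x -> M (cusp_step (lower x)).
  (* [cusp_step] vanishes at the vertex, so subtracting the vector of the vertex cancels the shift
     by [x0]. *)
  move=> x_ge0; have -> : cusp_step (lower x) = w (lower x) - w (lower 0).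
    by rewrite /w subr_subKA cusp_step_lower// cusp_step_lower// oppr0 L1_step0 oppr0 subr0.
  by apply: M_sub; exact: span_w.
have M_upper x : 0 <= x -> M (cusp_step (upper x)).
  move=> x_ge0; have -> : cusp_step (upper x) = w (upper x) - w (lower 0).
    by rewrite /w subr_subKA (cusp_step_lower (lexx 0)) oppr0 L1_step0 oppr0 subr0.
  by apply: M_sub; exact: span_w.
have M_step y : M (L1_step y).
  have [y0|y0] := leP y 0.
    have -> : L1_step y = -1 *: cusp_step (lower (- y)).
      by rewrite cusp_step_lower ?oppr_ge0// scaleN1r !opprK.
    by apply: M_scale; apply: M_lower; rewrite oppr_ge0.
  have [x x_gt0 <-] := cusp_scale_surj y0; have x_ge0 := ltW x_gt0.
  have -> : L1_step (cusp_scale x) =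
      expR (- x^-1) *: (cusp_step (upper x) - cusp_step (lower x)).
    by rewrite cusp_step_upper// addrK scalerA -expRD addNr expR0 scale1r.
  by apply: M_scale; apply: M_sub; [exact: M_upper|exact: M_lower].
apply: (@L1_itv_dense _ M) => //; first exact: closed_closure.
by move=> a b ab; rewrite -L1_stepB//; exact: M_sub.
Qed.

End CuspEmbedding.

Theorem corollary1p1 (R : realType) (x0 : Cusp R) :
  exists (d : measure_display) (Z : measurableType d)
    (mu : {measure set Z -> \bar R}),
    isomorphic (free_space x0) (LspaceType1 mu).
Proof.
(* The vectors are [cusp_step p - cusp_step x0], so the weights of both points add up. *)
pose c (p : Cusp R) := (1 + expR (p.1)^-1) + (1 + expR (x0.1)^-1).
exists _, (measurableTypeR R), (@lebesgue_measure R).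
(* The constant 4 comes from [cusp_step_lip], the constant 3 from [cusp_step_approx]. *)
apply: (@free_space_isomorphic R (Cusp R) x0 (LspaceType1 (@lebesgue_measure R))
  (fun p => cusp_step p - cusp_step x0) c 4 3) => //.
- by move=> p; rewrite !addr_ge0 ?expR_ge0.
- exact: L1_norming.
- exact: subrr.
- by move=> p q; rewrite subr_subKA; exact: cusp_step_lip.
- move=> f e e0; have [J J_le J_step] := cusp_step_approx f e0; exists J => // p.
  rewrite linearB /= /c mulrDl.
  have -> : J (cusp_step p) - J (cusp_step x0) - f p =
      (J (cusp_step p) - (f p - f (lower 0))) -
      (J (cusp_step x0) - (f x0 - f (lower 0))) by rewrite Lip0_base; ring.
  by rewrite (le_trans (ler_normB _ _))// lerD.
- exact: L1_complete.
- exact: cusp_step_dense.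
Qed.
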